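(* Given a string $S[1..n]$ over $[1..\sigma]$ and an integer $k\geq1$, a minimal $k$-attractor of $S$ can be found in $\mathcal O(\min\{n^2,nk^2,n+\sigma^{2k-1}k^2\})$ expected time.
   Context: A set $\Gamma\subseteq[1..n]$ is a $k$-attractor of $S$ if every substring $S[i..j]$ with $i\leq j<i+k$ has an occurrence $S[i'..j']=S[i..j]$ with $j''\in[i'..j']$ for some $j''\in\Gamma$. It is a minimal $k$-attractor if it is a $k$-attractor and $\Gamma\setminus\{j\}$ is not a $k$-attractor for any $j\in\Gamma$. Model: word RAM with words of $\Theta(\log n)$ bits. *)

(* Defs.v *)
From HB Require Import structures.
From mathcomp Require Import all_boot all_order all_algebra.

Set Implicit Arguments.
Unset Strict Implicit.
Unset Printing Implicit Defensive.

(** * String attractors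

   Strings are sequences of naturals; positions are numbered from 1. *)

(* S[i..j], meaningful for 1 <= i <= j <= size S. *)
Definition substring (S : seq nat) (i j : nat) : seq nat :=
  take (j - i).+1 (drop i.-1 S).

Definition attractor (k : nat) (S : seq nat) (G : {pred nat}) : Prop :=
  (forall j, j \in G -> 1 <= j <= size S) /\
  (forall i j, 1 <= i -> i <= j -> j <= size S -> j < i + k ->
     exists i' j' j'',
       [/\ [&& 1 <= i', i' <= j' & j' <= size S],
           substring S i' j' = substring S i j,
           j'' \in G
         & i' <= j'' <= j']).

Definition minimal_attractor (k : nat) (S : seq nat) (G : {pred nat}) : Prop :=
  attractor k S G /\
  (forall j, j \in G -> ~ attractor k S [predD1 G & j]).

(** * Randomized word RAM

   A program is a finite list of instructions, the same for all inputs and all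
   word sizes.  Every register and every memory cell holds a [w]-bit word, i.e.
   a natural below [2 ^ w]; in particular only [2 ^ w] cells are addressable.
   All instructions have unit cost. *)

Inductive binop :=
  | BAdd | BSub | BMul | BDiv | BMod | BAnd | BOr | BXor | BShl | BShr | BEq | BLt.

Definition eval_binop (w : nat) (o : binop) (x y : nat) : nat :=
  match o with
  | BAdd => (x + y) %% 2 ^ w
  | BSub => (x + (2 ^ w - y)) %% 2 ^ w
  | BMul => (x * y) %% 2 ^ w
  | BDiv => x %/ y
  | BMod => x %% y
  | BAnd => Nat.land x y
  | BOr  => Nat.lor x y
  | BXor => Nat.lxor x y
  | BShl => (x * 2 ^ y) %% 2 ^ w
  | BShr => x %/ 2 ^ y
  | BEq  => x == y
  | BLt  => x < y
  end.

(* [d], [a], [b] are register names and [l] is an absolute code address. *)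
Inductive instr :=
  | Const (d v : nat)             (* R[d] <- v mod 2^w *)
  | Op (o : binop) (d a b : nat)  (* R[d] <- R[a] o R[b] *)
  | Read (d a : nat)              (* R[d] <- M[R[a]] *)
  | Write (a b : nat)             (* M[R[a]] <- R[b] *)
  | Rand (d : nat)                (* R[d] <- uniformly random word *)
  | Jmp (l : nat)
  | Jz (a l : nat).               (* jump to l if R[a] = 0 *)

Definition program := seq instr.

Record config := Config { pc : nat; regs : nat -> nat; cells : nat -> nat }.

Definition upd (f : nat -> nat) (a v : nat) : nat -> nat :=
  fun x => if x == a then v else f x.

Definition halted (p : program) (c : config) : bool := size p <= pc c.

(* [r] is the fresh random word supplied to this step; only [Rand] reads it. *)
Definition step (w : nat) (p : program) (r : nat) (c : config) : config :=
  let: Config i R M := c in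
  match onth p i with
  | None => c
  | Some (Const d v) => Config i.+1 (upd R d (v %% 2 ^ w)) M
  | Some (Op o d a b) => Config i.+1 (upd R d (eval_binop w o (R a) (R b))) M
  | Some (Read d a) => Config i.+1 (upd R d (M (R a))) M
  | Some (Write a b) => Config i.+1 R (upd M (R a) (R b))
  | Some (Rand d) => Config i.+1 (upd R d r) M
  | Some (Jmp l) => Config l R M
  | Some (Jz a l) => Config (if R a == 0 then l else i.+1) R M
  end.

Fixpoint run (w : nat) (p : program) (rs : seq nat) (c : config) : config :=
  if rs is r :: rs' then run w p rs' (step w p r c) else c.

(* min(T, size rs), where T is the number of instructions executed before
   halting when the successive random words are those of [rs]. *)
Fixpoint time_upto (w : nat) (p : program) (rs : seq nat) (c : config) : nat :=
  if rs is r :: rs' then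
    if halted p c then 0 else (time_upto w p rs' (step w p r c)).+1
  else 0.

(* Tapes of [N] independent uniformly random words: the uniform distribution
   on [tape w N]. *)
Definition tape (w N : nat) := (N.-tuple 'I_(2 ^ w))%type.

Definition words (w N : nat) (r : tape w N) : seq nat :=
  [seq nat_of_ord x | x <- r].

(* E[min(T, N)], which depends only on the first N random words. *)
Definition expected_time_upto (w : nat) (p : program) (c : config) (N : nat) :
    rat :=
  ((\sum_(r : tape w N) time_upto w p (words r) c)%N%:R
     / #|{: tape w N}|%:R)%R.

(* E[T] <= B: by monotone convergence E[T] is the supremum over N of
   E[min(T, N)].  It forces the program to halt with probability 1. *)
Definition expected_time_le (w : nat) (p : program) (c : config) (B : nat) :
    Prop :=
  forall N : nat, (expected_time_upto w p c N <= B%:R)%R.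

(** * Input and output conventions *)

(* M[0] = n, M[1] = sigma, M[2] = k, M[3..n+2] = S[1..n]; all other cells and
   all registers are 0. *)
Definition input (S : seq nat) (sigma k : nat) : config :=
  Config 0 (fun _ => 0) (nth 0 [:: size S, sigma, k & S]).

(* The elements of the computed set are listed in M[1..M[0]]. *)
Definition output (c : config) : seq nat :=
  [seq cells c i | i <- iota 1 (cells c 0)].

(* Las Vegas correctness: every halting computation is correct. *)
Definition finds_minimal_attractor (w : nat) (p : program) (S : seq nat)
    (sigma k : nat) : Prop :=
  forall (N : nat) (r : tape w N),
    let c := run w p (words r) (input S sigma k) in
    halted p c ->
    uniq (output c) /\ minimal_attractor k S (mem (output c)).

(* floor(log2 n) + 1, a positive representative of Theta(log n). *)
Definition bit_length (n : nat) : nat := (trunc_log 2 n).+1.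

(* Main.v *)
Require Import Defs.
From mathcomp Require Import all_boot all_order all_algebra.
From mathcomp Require Import zify.
From Stdlib Require PeanoNat.
From Stdlib Require Import FunctionalExtensionality.

Set Implicit Arguments.
Unset Strict Implicit.
Unset Printing Implicit Defensive.

(* With K = min(k, n), only occurrences of length at most K matter.  A candidate
   set that is already a K-attractor is thinned from left to right while a
   counter keeps, for every distinct substring, the number of its occurrences
   that are still hit.  Removing g, with p the last kept point and x the next
   candidate, loses exactly the occurrences [s, e] with p < s <= g <= e < x;
   g is kept iff this sends a counter to 0.  Every pair (s, e) is examined a
   bounded number of times, which costs O(K D) for D the sum of the gaps between
   consecutive candidates, each capped at K.

   If sigma^K > n all positions are candidates and D <= n + 1.  Otherwise one end
   point per distinct window of length K suffices, besides the positions below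
   K, and D = O(sigma^K K); windows are recognised by their base-sigma value.

   Substrings get constant-time names by walking a trie whose edges are stored
   by direct addressing.  Memory is zero-initialised and has at least n^40
   cells, so no hashing is needed and the algorithm is deterministic; only the
   letters, which may fill a whole word, are first renamed in two steps, by
   their upper w - 1 bits and then by their last bit. *)

(** * A loop language and its compilation to the word RAM *)

(** One pass yields minimality because a set of positions contained in a non-attractor is no
    attractor: a point whose removal once lost a substring stays indispensable however many later
    points go. The test for g ranges over at most K starts s and, for each, at most min(K, x - g)
    ends e. The last kept point may lie far behind g, so the starts are bounded by K alone; only the
    ends are charged to gaps between candidates, whence K D. For D <= n + 1 this is O(n K), within
    both n^2 and n k^2, and within sigma^K k^2 if sigma^K > n; for D = O(sigma^K K) it is O(sigma^K
    K^2), within the third term as K <= 2 k - 1. The machine has only jumps, so the algorithm is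
    written with counted loops and compiled. Time is measured in loop iterations, and a factor fixed
    by the program text turns it into machine steps. No random word is ever read, so a bound on
    every single run bounds the expectation. *)

Inductive expr :=
  | Cst of nat | Var of nat | Bin of binop & expr & expr | Fetch of expr.

Inductive cmd :=
  | Skip | Asgn of nat & expr | Store of expr & expr | Seq of cmd & cmd
  | If of expr & cmd & cmd | Repeat of expr & cmd.

(* [ticks] counts the loop iterations performed so far. *)
Record state := State { env : nat -> nat; ram : nat -> nat; ticks : nat }.

Lemma upd_same f a v : upd f a v a = v.
Proof. by rewrite /upd eqxx. Qed.

Lemma upd_other f a v b : b != a -> upd f a v b = f b.
Proof. by rewrite /upd => /negPf->. Qed.

Section Semantics.
Variable w : nat.

Fixpoint eval (e : expr) (s : state) : nat :=
  match e with
  | Cst v => v %% 2 ^ w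
  | Var x => env s x
  | Bin o a b => eval_binop w o (eval a s) (eval b s)
  | Fetch a => ram s (eval a s)
  end.

Definition tick (s : state) := State (env s) (ram s) (ticks s).+1.

Fixpoint exec (c : cmd) (s : state) : state :=
  match c with
  | Skip => s
  | Asgn x e => State (upd (env s) x (eval e s)) (ram s) (ticks s)
  | Store a b => State (env s) (upd (ram s) (eval a s) (eval b s)) (ticks s)
  | Seq c d => exec d (exec c s)
  | If e c d => if eval e s == 0 then exec d s else exec c s
  | Repeat e c => iter (eval e s %% 2 ^ w) (fun s => exec c (tick s)) s
  end.

End Semantics.

(* Variables live in even registers, temporaries and loop counters in odd
   ones; code compiled at level [h] leaves the odd registers below [h] alone. *)
Definition usr (x : nat) := x.*2.
Definition hid (h : nat) := h.*2.+1.

Fixpoint compile_expr (e : expr) (h : nat) : seq instr :=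
  match e with
  | Cst v => [:: Const (hid h) v]
  | Var x => [:: Op BOr (hid h) (usr x) (usr x)]
  | Bin o a b =>
      compile_expr a h ++ compile_expr b h.+1
        ++ [:: Op o (hid h) (hid h) (hid h.+1)]
  | Fetch a => compile_expr a h ++ [:: Read (hid h) (hid h)]
  end.

(** Jump targets are absolute, hence [pos]. In [Repeat] the addition of 0 reduces the counter modulo
    [2 ^ w], as [exec] does: a fetched value is not known to be a word, and the decrement is exact
    only below [2 ^ w]. The body is compiled one level up, so it spares the counter. *)
Fixpoint compile (c : cmd) (pos h : nat) : seq instr :=
  match c with
  | Skip => [::]
  | Asgn x e => compile_expr e h ++ [:: Op BOr (usr x) (hid h) (hid h)]
  | Store a b =>
      compile_expr a h ++ compile_expr b h.+1 ++ [:: Write (hid h) (hid h.+1)]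
  | Seq c d =>
      let cc := compile c pos h in cc ++ compile d (pos + size cc) h
  | If e c d =>
      let ce := compile_expr e h in
      let cc := compile c (pos + size ce).+1 h in
      let pd := ((pos + size ce).+1 + size cc).+1 in
      let cd := compile d pd h in
      ce ++ Jz (hid h) pd :: cc ++ Jmp (pd + size cd) :: cd
  | Repeat e c =>
      let ce := compile_expr e h in
      let pl := ((pos + size ce).+2) in
      let cc := compile c pl.+1 h.+1 in
      let pe := (pl.+1 + size cc).+3 in
      ce ++ [:: Const (hid h.+1) 0, Op BAdd (hid h) (hid h) (hid h.+1),
                Jz (hid h) pe
              & cc ++ [:: Const (hid h.+1) 1;
                          Op BSub (hid h) (hid h) (hid h.+1); Jmp pl]]
  end.

(* Bounds the number of machine steps per loop iteration. *)
Fixpoint weight (c : cmd) : nat :=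
  match c with
  | Skip => 0
  | Asgn x e => size (compile_expr e 0) + 1
  | Store a b => size (compile_expr a 0) + size (compile_expr b 0) + 1
  | Seq c d => weight c + weight d
  | If e c d => size (compile_expr e 0) + weight c + weight d + 2
  | Repeat e c => size (compile_expr e 0) + weight c + 7
  end.

Definition deterministic (i : instr) := if i is Rand _ then false else true.

Lemma pred_mod w t : 0 < t < 2 ^ w -> (t + (2 ^ w - 1)) %% 2 ^ w = t.-1.
Proof.
move=> /andP[t0 tw]; have -> : t + (2 ^ w - 1) = t.-1 + 2 ^ w by lia.
by rewrite modnDr modn_small //; lia.
Qed.

Local Arguments onth : simpl never.

(** * Correctness and running time of compiled code *)

Section Compiler.
Variables (w : nat) (p : program).
Hypothesis w_gt0 : 0 < w.

Lemma size_compile_expr e h : size (compile_expr e h) = size (compile_expr e 0).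
Proof.
elim: e h => //= [o a IHa b IHb|a IHa] h; rewrite !size_cat /= ?(IHa h) //.
by rewrite (IHb h.+1) (IHb 1).
Qed.

Lemma deterministic_expr e h : all deterministic (compile_expr e h).
Proof.
by elim: e h => //= [o a IHa b IHb|a IHa] h; rewrite !all_cat ?IHa ?IHb.
Qed.

Lemma deterministic_compile c pos h : all deterministic (compile c pos h).
Proof.
elim: c pos h => //=.
- by move=> x e pos h; rewrite all_cat deterministic_expr.
- by move=> a b pos h; rewrite !all_cat !deterministic_expr.
- by move=> c IHc d IHd pos h; rewrite all_cat IHc IHd.
- by move=> e c IHc d IHd pos h; rewrite all_cat deterministic_expr /= all_cat IHc /= IHd.
- by move=> e c IHc pos h; rewrite all_cat deterministic_expr /= all_cat IHc.
Qed.

Definition code_at (pos : nat) (cs : seq instr) :=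
  exists pre post, p = pre ++ cs ++ post /\ size pre = pos.

Lemma code_at_cat pos cs ds :
  code_at pos (cs ++ ds) -> code_at pos cs /\ code_at (pos + size cs) ds.
Proof.
move=> [pre [post [pE <-]]]; split.
  by exists pre, (ds ++ post); rewrite pE -!catA.
by exists (pre ++ cs), post; rewrite pE -!catA size_cat.
Qed.

Lemma code_at_cons pos i cs :
  code_at pos (i :: cs) -> onth p pos = Some i /\ code_at pos.+1 cs.
Proof.
move=> [pre [post [pE <-]]]; split; last first.
  by exists (rcons pre i), post; rewrite size_rcons cat_rcons pE.
by rewrite pE; elim: (pre) => //=.
Qed.

Definition reach (t : nat) (c d : config) := iter t (step w p 0) c = d.

Lemma reach_trans t u c d e : reach t c d -> reach u d e -> reach (t + u) c e.
Proof. by rewrite /reach addnC iterD => -> ->. Qed.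

Definition agree (E R : nat -> nat) := forall x, R (usr x) = E x.
Definition keeps (h : nat) (R R' : nat -> nat) :=
  forall g, g < h -> R' (hid g) = R (hid g).

Lemma usr_hid x h : (usr x == hid h) = false.
Proof. rewrite /usr /hid; lia. Qed.
Lemma hid_usr x h : (hid h == usr x) = false.
Proof. rewrite /usr /hid; lia. Qed.
Lemma hid_eq g h : (hid g == hid h) = (g == h).
Proof. rewrite /hid; lia. Qed.
Lemma usr_eq x y : (usr x == usr y) = (x == y).
Proof. rewrite /usr; lia. Qed.

Definition updE := (usr_hid, hid_usr, hid_eq, usr_eq, eqxx).

Lemma agree_hid E R h v : agree E R -> agree E (upd R (hid h) v).
Proof. by move=> A x; rewrite /upd updE. Qed.

Lemma keeps_trans h g R1 R2 R3 :
  h <= g -> keeps h R1 R2 -> keeps g R2 R3 -> keeps h R1 R3.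
Proof. by move=> hg A B i ih; rewrite B ?A //; apply: leq_trans hg. Qed.

Lemma keeps_upd h R v : keeps h R (upd R (hid h) v).
Proof. by move=> i ih; rewrite /upd updE; case: eqP ih => [->|//]; rewrite ltnn. Qed.

Lemma compile_exprP e h pos R s :
  code_at pos (compile_expr e h) -> agree (env s) R ->
  exists R', [/\ reach (size (compile_expr e h)) (Config pos R (ram s))
                   (Config (pos + size (compile_expr e h)) R' (ram s)),
    agree (env s) R', keeps h R R' & R' (hid h) = eval w e s].
Proof.
elim: e h pos R => [v|x|o a IHa b IHb|a IHa] h pos R /=.
- move=> /code_at_cons[C _] A; exists (upd R (hid h) (v %% 2 ^ w)).
  split; [by rewrite /reach /= C addn1|exact: agree_hid|exact: keeps_upd|].
  by rewrite /upd eqxx.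
- move=> /code_at_cons[C _] A; exists (upd R (hid h) (env s x)).
  split; [|exact: agree_hid|exact: keeps_upd|by rewrite /upd eqxx].
  by rewrite /reach /= C addn1 /eval_binop A PeanoNat.Nat.lor_diag.
- move=> /code_at_cat[Ca /code_at_cat[Cb /code_at_cons[Co _]]] A.
  have [R1 [r1 A1 k1 e1]] := IHa _ _ _ Ca A.
  have [R2 [r2 A2 k2 e2]] := IHb _ _ _ Cb A1.
  exists (upd R2 (hid h) (eval_binop w o (eval w a s) (eval w b s))).
  split; last by rewrite /upd eqxx.
  + rewrite !size_cat !addnA; apply: reach_trans (reach_trans r1 r2) _.
    by rewrite /reach /= Co e2 (k2 h) // e1 addn1.
  + exact: agree_hid.
  + by apply: keeps_trans _ (keeps_trans _ k1 k2) (@keeps_upd h _ _) => //; exact: leqnSn.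
- move=> /code_at_cat[Ca /code_at_cons[Co _]] A.
  have [R1 [r1 A1 k1 e1]] := IHa _ _ _ Ca A.
  exists (upd R1 (hid h) (ram s (eval w a s))).
  split; last by rewrite /upd eqxx.
  + rewrite !size_cat !addnA; apply: reach_trans r1 _.
    by rewrite /reach /= Co e1 addn1.
  + exact: agree_hid.
  + by apply: keeps_trans _ k1 (@keeps_upd h _ _).
Qed.

Lemma exec_ticks c s : ticks s <= ticks (exec w c s).
Proof.
elim: c s => //= [c IHc d IHd|e c IHc d IHd|e c IHc] s.
- exact: leq_trans (IHc _) (IHd _).
- by case: ifP.
elim: (X in iter X) => //= t IH; apply: leq_trans IH _.
exact: leq_trans (leqnSn _) (IHc (tick _)).
Qed.

(** The time clause says [t <= weight c * (d + 1)], with d the ticks spent by [c], in a form that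
    adds up along [Seq]. The [+ 1] pays for straight-line code; each iteration of [Repeat] ticks
    before its body, and this tick pays for the [+ 1] of the body. *)
Lemma compileP c h pos R s :
  code_at pos (compile c pos h) -> agree (env s) R ->
  exists R' t, [/\ reach t (Config pos R (ram s))
      (Config (pos + size (compile c pos h)) R' (ram (exec w c s))),
    agree (env (exec w c s)) R', keeps h R R' &
    t + weight c * ticks s <= weight c * (ticks (exec w c s)).+1].
Proof.
elim: c h pos R s => [|x e|a b|c IHc d IHd|e c IHc d IHd|e c IHc] h pos R s /=.
- by move=> _ A; exists R, 0; rewrite addn0; split.
- move=> /code_at_cat[Ce /code_at_cons[Co _]] A.
  have [R1 [r1 A1 k1 e1]] := compile_exprP Ce A.
  exists (upd R1 (usr x) (eval w e s)), (size (compile_expr e h) + 1).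
  split.
  + rewrite size_cat addnA /=; apply: reach_trans r1 _.
    by rewrite /reach /= Co /eval_binop e1 PeanoNat.Nat.lor_diag addn1.
  + by move=> y; rewrite /upd updE; case: eqP.
  + by move=> g gh; rewrite /upd updE; apply: k1.
  + by rewrite size_compile_expr mulnS.
- move=> /code_at_cat[Ca /code_at_cat[Cb /code_at_cons[Co _]]] A.
  have [R1 [r1 A1 k1 e1]] := compile_exprP Ca A.
  have [R2 [r2 A2 k2 e2]] := compile_exprP Cb A1.
  exists R2, (size (compile_expr a h) + size (compile_expr b h.+1) + 1).
  split=> //.
  + rewrite !size_cat !addnA /=; apply: reach_trans (reach_trans r1 r2) _.
    by rewrite /reach /= Co e2 (k2 h) // e1 addn1.
  + by apply: keeps_trans _ k1 k2.
  + by rewrite !(size_compile_expr _ h) (size_compile_expr _ h.+1) mulnS.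
- move=> /code_at_cat[Cc Cd] A.
  have [R1 [t1 [r1 A1 k1 l1]]] := IHc _ _ _ _ Cc A.
  have [R2 [t2 [r2 A2 k2 l2]]] := IHd _ _ _ _ Cd A1.
  exists R2, (t1 + t2); split=> //.
  + by rewrite size_cat addnA; apply: reach_trans r1 r2.
  + by apply: keeps_trans _ k1 k2.
  + have := exec_ticks c s; have := exec_ticks d (exec w c s); nia.
- move=> /code_at_cat[Ce /code_at_cons[Cz /code_at_cat[Cc /code_at_cons[Cj Cd]]]] A.
  have [R1 [r1 A1 k1 e1]] := compile_exprP Ce A.
  rewrite !addSn in Cc Cd Cj Cz *.
  case: ifP => /eqP Ez.
  + have [R2 [t2 [r2 A2 k2 l2]]] := IHd _ _ _ _ Cd A1.
    exists R2, (size (compile_expr e h) + 1 + t2); split=> //.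
    * rewrite !size_cat /= size_cat /= !addnA.
      apply: reach_trans (reach_trans r1 _) _.
        by rewrite /reach /= Cz e1 Ez.
      by rewrite !addnS !addSn -!addnA in r2 *.
    * by apply: keeps_trans _ k1 k2.
    * have := exec_ticks d s; rewrite size_compile_expr; nia.
  + have [R2 [t2 [r2 A2 k2 l2]]] := IHc _ _ _ _ Cc A1.
    exists R2, (size (compile_expr e h) + 1 + t2 + 1); split=> //.
    * rewrite !size_cat /= size_cat /= !addnA.
      apply: reach_trans (reach_trans (reach_trans r1 _) r2) _.
        by rewrite /reach /= Cz e1 (introF eqP Ez).
      by rewrite /reach /= ?addSn Cj !addnS ?addSn -!addnA.
    * by apply: keeps_trans _ k1 k2.
    * have := exec_ticks c s; rewrite size_compile_expr; nia.
- move=> /code_at_cat[Ce /code_at_cons[C0 /code_at_cons[C1 /code_at_cons[Cz /code_at_cat[Cc]]]]].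
  move=> /code_at_cons[D0 /code_at_cons[D1 /code_at_cons[Cj _]]] A.
  have [R1 [r1 A1 k1 e1]] := compile_exprP Ce A.
  set pl := (pos + size (compile_expr e h)).+2 in C0 C1 Cz Cc D0 D1 Cj *.
  set cc := compile c pl.+1 h.+1 in C0 C1 Cz Cc D0 D1 Cj *.
  have w2 : 1 < 2 ^ w by rewrite -[1](expn0 2) ltn_exp2l.
  (* The 4 instructions around the body are the test, the constant, the decrement and the jump back;
     the final [+ 1] is the exit test. *)
  have loop m : forall s R, m < 2 ^ w -> agree (env s) R -> R (hid h) = m ->
     exists R' t, let s' := iter m (fun s => exec w c (tick s)) s in
     [/\ reach t (Config pl R (ram s)) (Config (pl.+1 + size cc).+3 R' (ram s')),
       agree (env s') R', keeps h R R' &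
       t + (weight c + 4) * ticks s <= (weight c + 4) * ticks s' + 1].
    elim: m => [|m IH] s1 R2 mw A2 Em.
      exists R2, 1; split=> //=; last by rewrite addnC.
      by rewrite /reach /= Cz Em.
    have [R3 [t3 [r3 A3 k3 l3]]] := IHc h.+1 pl.+1 R2 (tick s1) Cc A2.
    have E3 : R3 (hid h) = m.+1 by rewrite k3.
    set s3 := exec w c (tick s1) in r3 A3 l3.
    pose R4 := upd (upd R3 (hid h.+1) 1) (hid h) m.
    have A4 : agree (env s3) R4 by apply: agree_hid; apply: agree_hid.
    have [||R5 [t5 [r5 A5 k5 l5]]] := IH s3 R4 _ A4; first exact: ltnW.
      by rewrite /R4 /upd eqxx.
    exists R5, (1 + t3 + 3 + t5); rewrite iterSr -/s3; split=> //.
    + apply: reach_trans r5; apply: reach_trans (reach_trans _ r3) _.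
        by rewrite /reach /= Cz Em.
      rewrite /reach /= D0 /= D1 /= Cj /=; congr Config.
      rewrite /R4 (modn_small w2) /= upd_same upd_other ?hid_eq ?ltn_eqF //.
      by rewrite E3 pred_mod.
    + move=> g gh; rewrite k5 // /R4 /upd !updE !ltn_eqF ?k3 //; exact: ltnW.
    + move: l3 l5; rewrite -/s3 /tick /=.
      have := exec_ticks c (tick s1); rewrite -/s3 /=; nia.
  pose m := eval w e s %% 2 ^ w.
  pose R2 := upd (upd R1 (hid h.+1) 0) (hid h) m.
  have A2 : agree (env s) R2 by apply: agree_hid; apply: agree_hid.
  have [||R5 [t5 [r5 A5 k5 l5]]] := loop m s R2 _ A2.
  + by rewrite ltn_mod expn_gt0.
  + by rewrite /R2 /upd eqxx.
  exists R5, (size (compile_expr e h) + 2 + t5); split=> //.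
  + rewrite size_cat /= size_cat /=.
    have -> : pos + (size (compile_expr e h) + (size cc + 3).+3) = (pl.+1 + size cc).+3.
      by rewrite /pl; lia.
    apply: reach_trans r5; apply: reach_trans r1 _.
    rewrite /reach /= C0 /= C1 /=; congr Config.
    by rewrite /R2 mod0n upd_same addn0 upd_other ?hid_eq ?ltn_eqF // e1.
  + by move=> g gh; rewrite k5 // /R2 /upd !updE !ltn_eqF ?k1 //; exact: ltnW.
  + rewrite size_compile_expr; move: l5; rewrite -/m.
    have : ticks s <= ticks (iter m (fun s => exec w c (tick s)) s).
      by have := exec_ticks (Repeat e c) s.
    nia.
Qed.

End Compiler.

Lemma all_onth (T : Type) (a : pred T) (s : seq T) i x :
  all a s -> onth s i = Some x -> a x.
Proof.
elim: s i => [|y s IH] [|i] //= /andP[ay as_]; first by case=> <-.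
exact: IH.
Qed.

(** * Deterministic runs and expected time *)

Section Runs.
Variables (w : nat) (p : program).
Hypothesis p_det : all deterministic p.

Lemma step_det r c : step w p r c = step w p 0 c.
Proof.
case: c => i R M /=; case E: (onth p i) => [ins|//].
by case: ins E => // d /(all_onth p_det).
Qed.

Lemma run_det rs c : run w p rs c = iter (size rs) (step w p 0) c.
Proof. by elim: rs c => //= r rs IH c; rewrite IH step_det -iterSr. Qed.

Lemma halted_iter t c : halted p c -> iter t (step w p 0) c = c.
Proof.
move=> hc; elim: t => //= t ->; case: c hc => i R M /=.
by rewrite /halted /= onthE => le; rewrite nth_default // size_map.
Qed.

Lemma time_upto_le rs c t :
  halted p (iter t (step w p 0) c) -> time_upto w p rs c <= t.
Proof.
elim: rs c t => //= r rs IH c t; case: ifP => // nh; case: t => [|t].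
  by rewrite /= nh.
by rewrite iterSr ltnS step_det; exact: IH.
Qed.

Lemma expected_time_bound c B :
  (forall rs, time_upto w p rs c <= B) -> expected_time_le w p c B.
Proof.
move=> le N; rewrite /expected_time_upto.
have card_gt0 : 0 < #|{: tape w N}| by rewrite card_tuple card_ord expn_gt0 expn_gt0.
rewrite Num.Theory.ler_pdivrMr ?Num.Theory.ltr0n // -GRing.natrM Num.Theory.ler_nat.
by rewrite mulnC -sum_nat_const; apply: leq_sum => r _; exact: le.
Qed.

End Runs.

Lemma compile_run w c M : 0 < w ->
  let p := compile c 0 0 in
  let i := Config 0 (fun=> 0) M in
  let s := exec w c (State (fun=> 0) M 0) in
  (forall rs, halted p (run w p rs i) -> cells (run w p rs i) =1 ram s) /\
  (forall rs, time_upto w p rs i <= weight c * (ticks s).+1).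
Proof.
move=> w0 p i s; have dp := deterministic_compile c 0 0.
have C : code_at p 0 (compile c 0 0) by exists [::], [::]; rewrite cats0.
have [R [t [r _ _ le]]] := @compileP w p w0 c 0 0 (fun=> 0) (State (fun=> 0) M 0) C (fun=> erefl).
have ht : halted p (iter t (step w p 0) i) by rewrite r /halted /=.
split=> rs; last first.
  apply: leq_trans (time_upto_le dp rs ht) _.
  by rewrite muln0 addn0 in le.
rewrite (run_det w dp) -/p => hr.
(* Both runs have halted and a halted configuration is a fixed point, so the longer one ends where
   the shorter does. *)
have -> : iter (size rs) (step w p 0) i = iter t (step w p 0) i.
  have [lt|lt] := leqP t (size rs).
    by rewrite -(subnK lt) iterD (halted_iter _ _ ht).
  by rewrite -(subnK (ltnW lt)) iterD (halted_iter _ _ hr).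
by rewrite r.
Qed.

(** * Attractors and greedy thinning *)

Definition letter (S : seq nat) (i : nat) := nth 0 S i.-1.

Lemma size_substring S i j :
  1 <= i -> i <= j -> j <= size S -> size (substring S i j) = (j - i).+1.
Proof. by move=> i1 ij jn; rewrite size_takel // size_drop; lia. Qed.

Lemma nth_substring S i j r :
  1 <= i -> r <= j - i -> nth 0 (substring S i j) r = letter S (i + r).
Proof.
by move=> i1 rj; rewrite nth_take ?ltnS // nth_drop /letter; congr nth; lia.
Qed.

Lemma eq_substring S i j i' j' :
  1 <= i -> i <= j -> j <= size S -> 1 <= i' -> i' <= j' -> j' <= size S ->
  substring S i j = substring S i' j' <->
  j - i = j' - i' /\ forall r, r <= j - i -> letter S (i + r) = letter S (i' + r).
Proof.
move=> i1 ij jn i1' ij' jn'; split=> [E|[El E]].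
  have El : j - i = j' - i'.
    by have := congr1 size E; rewrite !size_substring // => -[].
  by split=> // r rl; rewrite -(@nth_substring S i j) // E nth_substring // -El.
apply: (@eq_from_nth _ 0) => [|r]; first by rewrite !size_substring // El.
rewrite size_substring // ltnS => rl.
by rewrite !nth_substring ?E // -El.
Qed.

Lemma eq_attractor k S (G G' : {pred nat}) :
  G =i G' -> attractor k S G -> attractor k S G'.
Proof.
move=> E [rng cov]; split=> [j|i j i1 ij jn jk]; first by rewrite -E; exact: rng.
have [i' [j' [g [h1 h2 h3 h4]]]] := cov i j i1 ij jn jk.
by exists i', j', g; rewrite -E.
Qed.

Lemma attractor_mono k S (G G' : {pred nat}) :
  {subset G <= G'} -> (forall j, j \in G' -> 1 <= j <= size S) ->
  attractor k S G -> attractor k S G'.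
Proof.
move=> sub rng [_ cov]; split=> [//|i j i1 ij jn jk].
have [i' [j' [g [h1 h2 h3 h4]]]] := cov i j i1 ij jn jk.
by exists i', j', g; rewrite sub.
Qed.

Lemma attractor_minn k S (G : {pred nat}) :
  attractor (minn k (size S)) S G <-> attractor k S G.
Proof.
split=> -[rng cov]; split=> // i j i1 ij jn jk; by apply: cov => //; lia.
Qed.

Lemma minimal_attractor_minn k S (G : {pred nat}) :
  minimal_attractor (minn k (size S)) S G -> minimal_attractor k S G.
Proof.
move=> [A B]; split; first exact/attractor_minn.
by move=> j /B nA /attractor_minn.
Qed.

(** * Hit counts and the removal of one point *)

Section Greedy.
Variables (S : seq nat) (K : nat).
Notation n := (size S).

Definition occ (q : nat * nat) :=
  [&& 1 <= q.1, q.1 <= q.2, q.2 <= n & q.2 < q.1 + K].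

Definition occs : seq (nat * nat) :=
  [seq q <- [seq (s, e) | s <- iota 1 n, e <- iota 1 n] | occ q].

Definition sub (q : nat * nat) := substring S q.1 q.2.
Definition hit (G : seq nat) (q : nat * nat) := has (fun g => q.1 <= g <= q.2) G.

Lemma mem_occs q : (q \in occs) = occ q.
Proof.
rewrite mem_filter andb_idr // => oq; move: q oq => [s e] /and4P[/= s1 se en _].
by rewrite allpairs_f // mem_iota; lia.
Qed.

Lemma uniq_occs : uniq occs.
Proof.
apply: filter_uniq; apply: allpairs_uniq; rewrite ?iota_uniq //.
by move=> [a b] [c d] _ _ /=.
Qed.

Lemma attractorP (G : seq nat) : {in G, forall g, 1 <= g <= n} ->
  attractor K S (mem G) <->
  forall q, occ q -> exists2 q', occ q' & sub q' = sub q /\ hit G q'.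
Proof.
move=> rng; split=> [[_ cov] [s e] /and4P[/= s1 se en eK]|cov]; last first.
  split=> [//|i j i1 ij jn jk].
  have [|[s e] /and4P[/= s1 se en eK] [E /hasP[g gG gse]]] := cov (i, j).
    by rewrite /occ i1 ij jn.
  by exists s, e, g; rewrite s1 se en.
have [i' [j' [g [/and3P[h1 h2 h3] E gG gij]]]] := cov s e s1 se en eK.
exists (i', j'); last by split=> //; apply/hasP; exists g.
have := congr1 size E; rewrite !size_substring // => -[].
by rewrite /occ /= h1 h2 h3; lia.
Qed.

(* The occurrences that contain g but avoid every other point, when p and x
   are the neighbours of g. *)
Definition rect (p g x : nat) : seq (nat * nat) :=
  [seq (s, e) | s <- iota (maxn p (g - K)).+1 (g - maxn p (g - K)),
                e <- iota g (minn x (s + K) - g)].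

Lemma mem_rect p g x s e : p < g ->
  ((s, e) \in rect p g x) = [&& p < s, s <= g, g <= e, e < x & e < s + K].
Proof.
move=> pg; apply/allpairsPdep/idP => [[a [b [+ + [-> ->]]]]|H].
  by rewrite !mem_iota; lia.
by exists s, e; split=> //; rewrite mem_iota; lia.
Qed.

Lemma uniq_rect p g x : uniq (rect p g x).
Proof.
apply: allpairs_uniq_dep => [|s _|[a b] [c d] _ _ /= [-> ->]//]; exact: iota_uniq.
Qed.

Lemma rect_occ p g x q : p < g -> x <= n.+1 -> q \in rect p g x -> occ q.
Proof. by move=> pg xn; case: q => s e; rewrite mem_rect // /occ /=; lia. Qed.

(** Only occurrences hit by the candidates [G0] get a meaningful name, since naming all would cost
    about n K whatever D is; hence [nameP] speaks of these alone. *)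
Variables (name : nat * nat -> nat) (G0 : seq nat).
Hypothesis nameP : forall q q', occ q -> occ q' -> hit G0 q -> hit G0 q' ->
  name q = name q' <-> sub q = sub q'.
Hypothesis G0_rng : {in G0, forall g, 1 <= g <= n}.

Definition cnt (G : seq nat) (c : nat) :=
  count (fun q => hit G q && (name q == c)) occs.

Section Removal.
Variables (out rest : seq nat) (p g x : nat).
Hypotheses (out_le : all (leq^~ p) out) (p_out : p \in 0 :: out).
Hypotheses (rest_ge : all (leq x) rest) (x_rest : x \in rcons rest n.+1).
Hypotheses (pg : p < g) (gx : g < x) (xn : x <= n.+1).

(** The kept points are at most p and the later ones at least x, so avoiding them means lying
    strictly between p and x. The values p = 0 and x = n + 1 stand for a missing neighbour: no
    occurrence reaches them. *)
Lemma rect_hit q : occ q -> (q \in rect p g x) =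
  hit (out ++ g :: rest) q && ~~ hit (out ++ rest) q.
Proof.
case: q => s e /and4P[/= s1 se en eK]; rewrite mem_rect // eK andbT.
rewrite /hit !has_cat /= orbCA negb_or.
apply/idP/idP => [/and4P[ps sg ge ex]|].
  rewrite sg ge /=; apply/andP; split; apply/hasPn => y yin /=.
    by have := allP out_le _ yin; lia.
  by have := allP rest_ge _ yin; lia.
move=> /andP[+ /andP[nout nrest]]; rewrite (negPf nout) (negPf nrest) !orbF => gse.
have ps : p < s.
  move: p_out; rewrite inE => /orP[/eqP->//|/(hasPn nout)] /=; lia.
have ex : e < x.
  move: x_rest; rewrite mem_rcons inE => /orP[/eqP->//|/(hasPn nrest)] /=; lia.
by lia.
Qed.

Lemma hit_drop q : hit (out ++ rest) q -> hit (out ++ g :: rest) q.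
Proof. by rewrite /hit !has_cat /=; case: (has _ out) => //= ->; rewrite orbT. Qed.

Lemma cnt_removal c :
  cnt (out ++ g :: rest) c =
  cnt (out ++ rest) c + count (fun q => name q == c) (rect p g x).
Proof.
have P : perm_eq [seq q <- occs | q \in rect p g x] (rect p g x).
  apply: uniq_perm => [||q]; [exact: filter_uniq uniq_occs|exact: uniq_rect|].
  by rewrite mem_filter mem_occs andb_idr //; exact: rect_occ.
rewrite -(permP P) count_filter /cnt -count_predUI.
(* Being still hit and lying in the rectangle exclude each other, so the two counts add up to that
   of the union. *)
rewrite [X in _ + X](_ : _ = 0) ?addn0; last first.
  apply/eqP; rewrite -leqn0 leqNgt -has_count; apply/hasPn => q.
  rewrite mem_occs /= => oq; rewrite rect_hit //.
  by case: (hit _ q); case: (hit _ q); case: eqP.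
apply: eq_in_count => q; rewrite mem_occs /= => oq; rewrite rect_hit //.
have := @hit_drop q; case: (hit (out ++ rest) q) => [->|_] //=.
  by rewrite andbF orbF.
by rewrite andbT andbC.
Qed.

Hypothesis sub0 : {subset out ++ g :: rest <= G0}.

Lemma hit_sub0 q : hit (out ++ g :: rest) q -> hit G0 q.
Proof. by move=> /hasP[y /sub0 yG yq]; apply/hasP; exists y. Qed.

(** A substring is endangered only if its hit occurrence lies in the rectangle; otherwise that
    witness survives. So only the names met in the rectangle need inspection, and a positive counter
    provides another witness. *)
Lemma attractor_removal : attractor K S (mem (out ++ g :: rest)) ->
  attractor K S (mem (out ++ rest)) <->
  all (fun q => 0 < cnt (out ++ rest) (name q)) (rect p g x).
Proof.
have sub1 : {subset out ++ rest <= out ++ g :: rest}.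
  by move=> y; rewrite !mem_cat inE => /orP[->|->]; rewrite ?orbT.
have rng y : y \in out ++ g :: rest -> 1 <= y <= n by move/sub0/G0_rng.
move/attractorP => /(_ rng) cov; split=> [/attractorP cov'|pos].
  apply/allP => q qr; have oq := rect_occ pg xn qr.
  have hq : hit (out ++ g :: rest) q by move: qr; rewrite rect_hit // => /andP[].
  have [y /sub1/rng//|q' oq' [Eq hq']] := cov' _ q oq.
  rewrite -has_count; apply/hasP; exists q'; rewrite ?mem_occs // hq' /=.
  by apply/eqP/nameP => //; apply: hit_sub0 => //; exact: hit_drop.
apply/attractorP => [y /sub1/rng//|q oq].
have [q1 oq1 [E1 h1]] := cov q oq.
have [h|nh] := boolP (hit (out ++ rest) q1); first by exists q1.
have q1r : q1 \in rect p g x by rewrite rect_hit // h1.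
have := allP pos _ q1r; rewrite -has_count => /hasP[q2].
rewrite mem_occs => oq2 /andP[h2 /eqP N2]; exists q2 => //; split=> //.
by rewrite -E1; apply/nameP => //; apply: hit_sub0 => //; exact: hit_drop.
Qed.

End Removal.
End Greedy.

(** * Capped gaps: the quantity D *)

Fixpoint capped_gaps (K a : nat) (l : seq nat) : nat :=
  if l is x :: l' then minn K (x - a) + capped_gaps K x l' else 0.

Lemma capped_gapsE K a l :
  capped_gaps K a l =
  \sum_(t < size l) minn K (nth 0 (a :: l) t.+1 - nth 0 (a :: l) t).
Proof.
elim: l a => [|x l IH] a; first by rewrite big_ord0.
by rewrite /= big_ord_recl /= IH.
Qed.

Lemma capped_gaps_last K a l :
  path ltn a l -> capped_gaps K a l + a <= last a l.
Proof.
elim: l a => //= x l IH a /andP[ax /IH]; have := geq_minr K (x - a); lia.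
Qed.

(** Below K the gaps telescope to at most K - a; every element from K on contributes at most K. *)
Lemma capped_gaps_count K a l : path ltn a l ->
  capped_gaps K a l <= (K - a) + K * count (leq K) l.
Proof.
elim: l a => [|x l IH] a //= /andP[ax /IH le]; rewrite mulnDr.
by have := geq_minr K (x - a); have := geq_minl K (x - a); case: leqP => /=; nia.
Qed.

Lemma size_le_capped_gaps K a l :
  0 < K -> path ltn a l -> size l <= capped_gaps K a l.
Proof.
move=> K0; elim: l a => //= x l IH a /andP[ax /IH].
by have : 0 < minn K (x - a); lia.
Qed.

(* Marking a representative end point for each window of length K suffices:
   a substring of length at most K ending at i reappears at the end of the
   equal window. *)
Lemma windows_attractor S K (G : seq nat) :
  {in G, forall g, 1 <= g <= size S} ->
  (forall i, 1 <= i <= size S -> i \in G \/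
     exists j, [/\ j \in G, K <= i, K <= j &
       forall r, r < K -> letter S (i - r) = letter S (j - r)]) ->
  attractor K S (mem G).
Proof.
move=> rng cov; apply/attractorP => // -[s e] /and4P[/= s1 se en eK].
have [|eG|[j [jG Ke Kj E]]] := cov e; first by rewrite en andbT; lia.
  by exists (s, e); [rewrite /occ /= s1 se en|split=> //; apply/hasP; exists e => //=; lia].
have := rng _ jG; move=> /andP[j1 jn].
exists (j - (e - s), j); first by rewrite /occ /=; lia.
split; last by apply/hasP; exists j => //=; lia.
apply: (proj2 (@eq_substring S (j - (e - s)) j s e _ _ _ _ _ _)); try lia.
split=> [|r rl]; first lia.
have -> : j - (e - s) + r = j - (e - s - r) by lia.
have -> : s + r = e - (e - s - r) by lia.
by rewrite E //; lia.
Qed.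

Lemma eq_mod_range d a b :
  1 <= a <= d -> 1 <= b <= d -> a = b %[mod d] -> a = b.
Proof.
wlog ab : a b / a <= b => [W|] ra rb E.
  by case/orP: (leq_total a b) => le; [|symmetry]; apply: W.
move/esym/eqP: E; rewrite eqn_mod_dvd // => dv.
have [z|nz] := posnP (b - a); first lia.
by have := dvdn_leq nz dv; lia.
Qed.

(** * Window codes in base sigma *)

Section Codes.
Variables (S : seq nat) (w sigma P : nat).

(* The mod 2 ^ w are those of the machine; they are harmless when P <= n. *)
Fixpoint code (i : nat) : nat :=
  if i is i'.+1 then
    (((code i' * sigma) %% 2 ^ w + letter S i) %% 2 ^ w) %% P
  else 0.

Hypothesis letters : forall i, 1 <= i <= size S -> 1 <= letter S i <= sigma.
Hypotheses (P0 : 0 < P) (nowrap : P * sigma + sigma < 2 ^ w).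

Lemma code_lt i : code i < P.
Proof. by case: i => //= i; rewrite ltn_mod. Qed.

Lemma codeS i : i < size S -> code i.+1 = (code i * sigma + letter S i.+1) %% P.
Proof.
move=> iS /=; have := code_lt i; have := letters (i := i.+1).
move=> L C; have {}L := L iS.
have ? : code i * sigma <= P * sigma by rewrite leq_mul2r (ltnW C) orbT.
by rewrite !(@modn_small _ (2 ^ w)) //; rewrite ?(@modn_small _ (2 ^ w)) //; lia.
Qed.

(** The letters 1..sigma represent each residue modulo sigma once, sigma standing for 0. So the last
    letter is read off modulo sigma, and the rest follows after division by sigma. Reduction modulo
    P loses nothing here since [sigma ^ q] divides P. *)
Lemma code_inj q i j :
  sigma ^ q %| P -> q <= i <= size S -> q <= j <= size S ->
  code i = code j %[mod sigma ^ q] ->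
  forall r, r < q -> letter S (i - r) = letter S (j - r).
Proof.
elim: q i j => [//|q IH] [|i] [|j] // dP iS jS.
have s0 : 0 < sigma by have := letters (i := i.+1); lia.
rewrite !codeS; [|lia..]; rewrite !(modn_dvdm _ dP) => E.
have Li := letters (i := i.+1); have Lj := letters (i := j.+1).
have EL : letter S i.+1 = letter S j.+1.
  have := congr1 (modn^~ sigma) E; rewrite !modn_dvdm ?dvdn_exp //.
  rewrite !modnMDl => Em.
  by apply: eq_mod_range Em; [apply: Li|apply: Lj]; lia.
move=> [|r] rq; first by rewrite !subn0.
rewrite !subSS; apply: IH => //; try lia.
  by apply: dvdn_trans dP; rewrite dvdn_exp2l.
move/eqP: E; rewrite EL eqn_modDr -!(mulnC sigma) expnS -!muln_modr.
by rewrite eqn_pmul2l // => /eqP.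
Qed.

End Codes.

(** The constant is 3 + 33. In the third term with P <= n, K D <= K^2 (P + 2) <= 3 P K^2, hence 33.
    Everywhere else K D <= 2 K n suffices, and K n is bounded by n^2, by n k^2, or, for n <
    [sigma ^ K], by [sigma ^ K * k ^ 2]. *)
Lemma cost_bound_arith n k K D P sigma :
  0 < n -> 0 < K <= n -> K <= k -> 0 < sigma -> 0 < P ->
  D <= n.+1 -> (P <= n -> P = sigma ^ K /\ D <= K + K * P.+1) ->
  (n < P -> n < sigma ^ K) ->
  3 * n + 11 * (K * D) <=
  36 * minn (n ^ 2) (minn (n * k ^ 2) (n + sigma ^ (2 * k - 1) * k ^ 2)).
Proof.
move=> n0 /andP[K0 Kn] Kk s0 P0 DS small large.
have pw : sigma ^ K <= sigma ^ (2 * k - 1) by apply: leq_pexp2l; lia.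
have KD : K * D <= 2 * (K * n).
  by have := leq_mul (leqnn K) DS; have := leq_mul (leqnn K) n0; lia.
have kk : K * K <= k ^ 2 by rewrite expnS expn1; apply: leq_mul.
have k2 : K * 1 <= k ^ 2 by apply: leq_trans kk; apply: leq_mul.
have nk : n <= n * k ^ 2 by apply: leq_pmulr; lia.
have Knk : K * n <= n * k ^ 2 by rewrite mulnC; apply: leq_mul; lia.
move: (k ^ 2) kk k2 nk Knk => kq kk k2 nk Knk.
move: (sigma ^ (2 * k - 1)) pw => X pw.
rewrite /minn; case: ifP => _; last case: ifP => _.
- have := leq_mul Kn (leqnn n); have := leq_mul n0 (leqnn n); rewrite expnS expn1; lia.
- by lia.
have [Pn|nP] := leqP P n.
  have [PE DP] := small Pn.
  have PX : P * (K * K) <= X * kq by apply: leq_mul => //; rewrite PE.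
  have := leq_mul (leqnn K) DP; have := leq_mul P0 (leqnn (K * K)); lia.
have nX : K * n <= X * kq.
  rewrite mulnC; apply: leq_mul; last lia.
  by apply: leq_trans (ltnW (large nP)) pw.
by lia.
Qed.

(** * The program *)

Fixpoint mods (c : cmd) (x : nat) : bool :=
  match c with
  | Asgn y _ => x == y
  | Seq c d | If _ c d => mods c x || mods d x
  | Repeat _ c => mods c x
  | _ => false
  end.

Section WP.
Variable w : nat.

Definition wp (c : cmd) (Q : state -> Prop) (s : state) := Q (exec w c s).

Lemma wp_seq c d Q s : wp c (wp d Q) s -> wp (Seq c d) Q s.
Proof. by []. Qed.

Lemma wp_skip (Q : state -> Prop) s : Q s -> wp Skip Q s.
Proof. by []. Qed.

Lemma wp_asgn x e Q E M T v :
  eval w e (State E M T) = v -> Q (State (upd E x v) M T) ->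
  wp (Asgn x e) Q (State E M T).
Proof. by rewrite /wp /= => ->. Qed.

Lemma wp_store a b Q E M T u v :
  eval w a (State E M T) = u -> eval w b (State E M T) = v ->
  Q (State E (upd M u v) T) -> wp (Store a b) Q (State E M T).
Proof. by rewrite /wp /= => -> ->. Qed.

Lemma wp_if e c d Q s v : eval w e s = v ->
  (v != 0 -> wp c Q s) -> (v = 0 -> wp d Q s) -> wp (If e c d) Q s.
Proof. by rewrite /wp /= => ->; case: eqP => [v0 _ h|/eqP v0 h _]; exact: h. Qed.

Lemma wp_repeat (I : nat -> state -> Prop) e c Q s m :
  eval w e s = m -> m < 2 ^ w -> I 0 s ->
  (forall j E M T, j < m -> I j (State E M T) -> wp c (I j.+1) (State E M T.+1)) ->
  (forall s', I m s' -> Q s') -> wp (Repeat e c) Q s.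
Proof.
move=> Em mw I0 IS; apply; rewrite /wp /= Em modn_small //.
suff: forall j, j <= m -> I j (iter j (fun s => exec w c (tick s)) s) by apply.
elim=> //= j IH jm; have {IH} := IH (ltnW jm).
by case: (iter j _ s) => E M T; exact: IS.
Qed.

Lemma wp_conseq c (Q Q' : state -> Prop) s :
  wp c Q s -> (forall s', Q s' -> Q' s') -> wp c Q' s.
Proof. by move=> h; apply. Qed.

Lemma exec_frame c s x : ~~ mods c x -> env (exec w c s) x = env s x.
Proof.
elim: c s => //= [y e|c IHc d IHd|e c IHc d IHd|e c IHc] s.
- by rewrite /upd => /negPf->.
- by rewrite negb_or => /andP[hc hd]; rewrite IHd ?IHc.
- by rewrite negb_or => /andP[hc hd]; case: ifP; rewrite ?IHd ?IHc.
- by move=> hc; elim: (X in iter X) => //= m IH; rewrite IHc.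
Qed.

(** Supplies the values of unassigned variables after a subprogram, so that its specification need
    not list them. *)
Lemma wp_frame c Q s :
  wp c (fun s' => (forall x, ~~ mods c x -> env s' x = env s x) -> Q s') s ->
  wp c Q s.
Proof. by rewrite /wp; apply=> x; exact: exec_frame. Qed.

Lemma eval_cst v s : v < 2 ^ w -> eval w (Cst v) s = v.
Proof. exact: modn_small. Qed.

Lemma eval_var x s v : env s x = v -> eval w (Var x) s = v.
Proof. by []. Qed.

Lemma eval_load e s a v : eval w e s = a -> ram s a = v -> eval w (Fetch e) s = v.
Proof. by move=> /= ->. Qed.

(** The program text cannot mention w; this wrapped difference is its access to the word length.
    Half of it plus 1 is [H], and as an increment it acts as -1. *)
Lemma eval_max_word s : 1 < 2 ^ w -> eval w (Bin BSub (Cst 0) (Cst 1)) s = 2 ^ w - 1.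
Proof. by move=> w1; rewrite /= mod0n add0n !modn_small //; lia. Qed.

Section Bin.
Variables (e f : expr) (s : state) (x y : nat).
Hypotheses (ex : eval w e s = x) (ey : eval w f s = y).

Lemma eval_add : x + y < 2 ^ w -> eval w (Bin BAdd e f) s = x + y.
Proof. by rewrite /= ex ey; exact: modn_small. Qed.

Lemma eval_addm : eval w (Bin BAdd e f) s = (x + y) %% 2 ^ w.
Proof. by rewrite /= ex ey. Qed.

Lemma eval_mulm : eval w (Bin BMul e f) s = (x * y) %% 2 ^ w.
Proof. by rewrite /= ex ey. Qed.

Lemma eval_mul : x * y < 2 ^ w -> eval w (Bin BMul e f) s = x * y.
Proof. by rewrite /= ex ey; exact: modn_small. Qed.

Lemma eval_sub : y <= x < 2 ^ w -> eval w (Bin BSub e f) s = x - y.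
Proof.
rewrite /= ex ey => xy; have -> : x + (2 ^ w - y) = x - y + 2 ^ w by lia.
by rewrite modnDr modn_small //; lia.
Qed.

Lemma eval_div : eval w (Bin BDiv e f) s = x %/ y.
Proof. by rewrite /= ex ey. Qed.

Lemma eval_mod : eval w (Bin BMod e f) s = x %% y.
Proof. by rewrite /= ex ey. Qed.

Lemma eval_lt : eval w (Bin BLt e f) s = (x < y).
Proof. by rewrite /= ex ey. Qed.

End Bin.
End WP.

Declare Scope prog_scope.
Delimit Scope prog_scope with prog.
Bind Scope prog_scope with expr.
Bind Scope prog_scope with cmd.
Local Infix "+" := (Bin BAdd) : prog_scope.
Local Infix "-" := (Bin BSub) : prog_scope.
Local Infix "*" := (Bin BMul) : prog_scope.
Local Infix "%/" := (Bin BDiv) : prog_scope.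
Local Infix "%%" := (Bin BMod) : prog_scope.
Local Infix "<" := (Bin BLt) : prog_scope.
Local Notation "x ::= e" := (Asgn x e%prog) (at level 71, no associativity) : prog_scope.
Local Notation "c ;; d" := (Seq c d) (at level 72, right associativity) : prog_scope.
Local Notation "` x" := (Var x) (at level 1, format "` x") : prog_scope.
Local Notation "# v" := (Cst v) (at level 1, format "# v") : prog_scope.

Local Notation vn := 0 (only parsing).
Local Notation vsg := 1 (only parsing).
Local Notation vK := 2 (only parsing).
Local Notation vz := 3 (only parsing).
Local Notation vZ := 4 (only parsing).
Local Notation vH := 5 (only parsing).
Local Notation vF := 7 (only parsing).
Local Notation vC := 8 (only parsing).
Local Notation vN := 9 (only parsing).
Local Notation vR := 10 (only parsing).
Local Notation vD := 11 (only parsing).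
Local Notation vfr := 12 (only parsing).
Local Notation vi := 13 (only parsing).
Local Notation vx := 14 (only parsing).
Local Notation va := 15 (only parsing).
Local Notation vv := 16 (only parsing).
Local Notation vP := 17 (only parsing).
Local Notation vcd := 18 (only parsing).
Local Notation vm := 19 (only parsing).
Local Notation vf := 20 (only parsing).
Local Notation vt := 21 (only parsing).
Local Notation vg := 22 (only parsing).
Local Notation vp := 23 (only parsing).
Local Notation vlo := 24 (only parsing).
Local Notation vs := 25 (only parsing).
Local Notation vhi := 26 (only parsing).
Local Notation ve := 27 (only parsing).
Local Notation vd := 28 (only parsing).
Local Notation vfl := 29 (only parsing).
Local Notation voc := 30 (only parsing).
Local Notation vc := 31 (only parsing).

(* Memory layout, with Z = (n + 4)^2: input and output in [0, Z), candidate
   positions from Z, seen window codes from 2Z, occurrence counters from 3Z,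
   names of the occurrences from 4Z, names of the letters from 5Z.  Everything
   from 6Z on is the dictionary; its upper half, from H = 2 ^ (w - 1), is
   indexed by the halved letters. *)
Definition init : cmd := (
  vn ::= Fetch #0;;
  vsg ::= Fetch #1;;
  If (`vn < `vsg) (vsg ::= `vn + #1) Skip;;
  vK ::= Fetch #2;;
  If (`vn < `vK) (vK ::= `vn) Skip;;
  vz ::= `vn + #4;;
  vZ ::= `vz * `vz;;
  vH ::= (#0 - #1) %/ #2 + #1;;
  vF ::= #2 * `vZ;;
  vC ::= #3 * `vZ;;
  vN ::= #4 * `vZ;;
  vR ::= #5 * `vZ;;
  vD ::= #6 * `vZ)%prog.

(** A zero cell is an edge not yet created. Fresh names start at 1, which leaves 0 free to denote
    the root of the trie. *)
Definition lookup : cmd := (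
  vv ::= Fetch `va;;
  If `vv Skip (vfr ::= `vfr + #1;; vv ::= `vfr;; Store `va `vv))%prog.

(** A table indexed by whole letters could need all [2 ^ w] cells. Halved letters fit into the upper
    half of the memory, and the dropped bit becomes a second edge. *)
Definition rank_letters : cmd := (
  vfr ::= #0;;
  vi ::= #0;;
  Repeat `vn (
    vi ::= `vi + #1;;
    vx ::= Fetch (`vi + #2);;
    va ::= `vH + `vx %/ #2;;
    lookup;;
    va ::= `vD + `vv * `vZ + `vx %% #2;;
    lookup;;
    Store (`vR + `vi) `vv))%prog.

(** Stopping beyond n keeps every product within n (n + 1), as [init] has cut [vsg] at n + 1. A
    final P > n signals that every position is a candidate. *)
Definition capped_power : cmd := (
  vP ::= #1;;
  Repeat `vK (If (`vn < `vP) Skip (vP ::= `vP * `vsg)))%prog.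

(** Codes are marked only from position K on, so a position where no full window ends is always
    chosen. The cell at address Z stays 0 and n + 1 is stored last: these are the sentinels for
    missing neighbours. *)
Definition select : cmd := (
  vcd ::= #0;;
  vm ::= #0;;
  vi ::= #0;;
  Repeat `vn (
    vi ::= `vi + #1;;
    vcd ::= (`vcd * `vsg + Fetch (`vi + #2)) %% `vP;;
    vf ::= Fetch (`vF + `vcd);;
    If (`vn < `vP) (vf ::= #0) Skip;;
    If `vf Skip (vm ::= `vm + #1;; Store (`vZ + `vm) `vi);;
    If (`vi < `vK) Skip (Store (`vF + `vcd) #1));;
  Store (`vZ + (`vm + #1)) (`vn + #1))%prog.

(** Machine subtraction wraps around, so [maxn p (g - K)] needs a test. *)
Definition window_start : cmd := (
  vlo ::= `vp;;
  If (`vp + `vK < `vg) (vlo ::= `vg - `vK) Skip)%prog.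

(** One trie walk names every prefix of the longest window from s, also those ending before the
    candidate: the walk to the longer ones passes through them. *)
Definition name_row : cmd := (
  vhi ::= `vs + `vK;;
  If (`vn + #1 < `vhi) (vhi ::= `vn + #1) Skip;;
  vv ::= #0;;
  ve ::= `vs;;
  Repeat (`vhi - `vs) (
    va ::= `vD + `vv * `vZ + Fetch (`vR + `ve);;
    lookup;;
    Store (`vN + `vs * `vz + `ve) `vv;;
    ve ::= `ve + #1))%prog.

Definition name_occurrences : cmd := (
  vt ::= #0;;
  Repeat `vm (
    vp ::= Fetch (`vZ + `vt);;
    vt ::= `vt + #1;;
    vg ::= Fetch (`vZ + `vt);;
    window_start;;
    vs ::= `vlo;;
    Repeat (`vg - `vlo) (vs ::= `vs + #1;; name_row)))%prog.

Definition sweep : cmd := (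
  window_start;;
  vs ::= `vlo;;
  Repeat (`vg - `vlo) (
    vs ::= `vs + #1;;
    vhi ::= `vs + `vK;;
    If (`vx < `vhi) (vhi ::= `vx) Skip;;
    ve ::= `vg;;
    Repeat (`vhi - `vg) (
      va ::= `vC + Fetch (`vN + `vs * `vz + `ve);;
      vc ::= Fetch `va + `vd;;
      Store `va `vc;;
      If `vc Skip (vfl ::= #0);;
      ve ::= `ve + #1)))%prog.

Definition count_hits : cmd := (
  vt ::= #0;;
  Repeat `vm (
    vp ::= Fetch (`vZ + `vt);;
    vt ::= `vt + #1;;
    vg ::= Fetch (`vZ + `vt);;
    vx ::= `vn + #1;;
    vd ::= #1;;
    sweep))%prog.

(** The test is destructive: the counters are lowered as if g were removed, and raised again if one
    vanished. The output may overwrite the input, since from here on only the other tables are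
    read. *)
Definition greedy : cmd := (
  vt ::= #0;;
  vp ::= #0;;
  voc ::= #0;;
  Repeat `vm (
    vt ::= `vt + #1;;
    vg ::= Fetch (`vZ + `vt);;
    vx ::= Fetch (`vZ + (`vt + #1));;
    vfl ::= #1;;
    vd ::= #0 - #1;;
    sweep;;
    If `vfl Skip (
      vd ::= #1;;
      sweep;;
      voc ::= `voc + #1;;
      Store `voc `vg;;
      vp ::= `vg));;
  Store #0 `voc)%prog.

Definition find_attractor : cmd := (
  init;; rank_letters;; capped_power;; select;; name_occurrences;;
  count_hits;; greedy)%prog.

(** * Verification *)

Lemma upd_upd f a u v : upd (upd f a u) a v = upd f a v.
Proof. by apply: functional_extensionality => x; rewrite /upd; case: eqP. Qed.

Lemma upd_id f a v : f a = v -> upd f a v = f.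
Proof. by move=> <-; apply: functional_extensionality => x; rewrite /upd; case: eqP => [->|]. Qed.

Lemma upd_swap f a b u v : a != b -> upd (upd f a u) b v = upd (upd f b v) a u.
Proof.
move=> ab; apply: functional_extensionality => x; rewrite /upd.
by case: eqP => // ->; rewrite eq_sym (negPf ab).
Qed.

(** Merges the two outcomes of a clamping test into one state, so that what follows is verified
    once. *)
Lemma wp_cond_asgn w e x a Q E M T (b : bool) u v :
  eval w e (State (upd E x u) M T) = b ->
  (b -> eval w a (State (upd E x u) M T) = v) ->
  Q (State (upd E x (if b then v else u)) M T) ->
  wp w (If e (Asgn x a) Skip) Q (State (upd E x u) M T).
Proof.
move=> eb ea HQ; apply: (wp_if eb) => [b1|b0].
  by move: b1 ea HQ; case: b {eb} => //= _ /(_ isT) ea HQ; apply: (wp_asgn ea); rewrite upd_upd.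
by move: b0 HQ; case: b {eb ea}.
Qed.

(** * Memory invariants: dictionary and letter ranks *)

Section Verification.
Variables (w sg K z Z H : nat) (S : seq nat).
Notation n := (size S).
(** [ZH] keeps the edge addresses [6 * Z + v * Z + r], with v and r below Z, from wrapping around,
    and puts the table at [H] above [6 * Z]. *)
Hypotheses (zE : z = n + 4) (ZE : Z = z * z) (HW : H + H = 2 ^ w).
Hypotheses (ZH : Z * Z + 8 * Z < H) (K_gt0 : 0 < K) (K_le : K <= n).
Hypothesis letter_lt : forall i, 1 <= i <= n -> letter S i < 2 ^ w.

Record consts (E : nat -> nat) : Prop := Consts {
  consts_n : E vn = n; consts_sg : E vsg = sg; consts_K : E vK = K;
  consts_z : E vz = z; consts_Z : E vZ = Z; consts_H : E vH = H;
  consts_F : E vF = 2 * Z; consts_C : E vC = 3 * Z; consts_N : E vN = 4 * Z;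
  consts_R : E vR = 5 * Z; consts_D : E vD = 6 * Z }.

Lemma consts_eq E E' : (forall x, x < 12 -> E' x = E x) -> consts E -> consts E'.
Proof. by move=> eq [] *; split; rewrite eq. Qed.

Lemma consts_upd E x v : 12 <= x -> consts E -> consts (upd E x v).
Proof. by move=> x12; apply: consts_eq => y y12; rewrite upd_other //; lia. Qed.

Lemma consts_frame c E E' :
  all (predC (mods c)) (iota 0 12) -> (forall x, ~~ mods c x -> E' x = E x) ->
  consts E -> consts E'.
Proof.
move=> /allP nm eq; apply: consts_eq => x x12; apply: eq.
by apply: nm; rewrite mem_iota.
Qed.

Ltac lk := rewrite /= /upd /=;
  first [ eassumption
        | eapply consts_n; eassumption | eapply consts_sg; eassumption
        | eapply consts_K; eassumption | eapply consts_z; eassumption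
        | eapply consts_Z; eassumption | eapply consts_H; eassumption
        | eapply consts_F; eassumption | eapply consts_C; eassumption
        | eapply consts_N; eassumption | eapply consts_R; eassumption
        | eapply consts_D; eassumption | reflexivity ].

Ltac ev := lazymatch goal with
  | |- eval _ (Bin BAdd _ _) _ = _ => eapply eval_add; [ev|ev|try lia]
  | |- eval _ (Bin BSub _ _) _ = _ => eapply eval_sub; [ev|ev|try lia]
  | |- eval _ (Bin BMul _ _) _ = _ => eapply eval_mul; [ev|ev|try lia]
  | |- eval _ (Bin BDiv _ _) _ = _ => eapply eval_div; [ev|ev]
  | |- eval _ (Bin BMod _ _) _ = _ => eapply eval_mod; [ev|ev]
  | |- eval _ (Bin BLt _ _) _ = _ => eapply eval_lt; [ev|ev]
  | |- eval _ (Cst _) _ = _ => apply: eval_cst; try lia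
  | |- eval _ (Var _) _ = _ => apply: eval_var; lk
  | |- eval _ (Fetch _) _ = _ =>
      eapply eval_load; [ev|rewrite /=; first [eassumption|reflexivity]]
  end.

Ltac sq := lazymatch goal with |- wp _ (Seq _ _) _ _ => apply: wp_seq | _ => idtac end.
Ltac asg := sq; eapply wp_asgn; [ev|].
Ltac sto := sq; eapply wp_store; [ev|ev|].

Lemma z_le_Z : 4 * z <= Z.
Proof. by rewrite ZE leq_mul2r zE; lia. Qed.

Lemma Z_split : Z = n * z + 4 * z.
Proof. by rewrite ZE {1}zE mulnDl. Qed.

(* Every word of the dictionary identifies the address that holds it. *)
Definition dict (M : nat -> nat) (fr : nat) :=
  (forall a, 6 * Z <= a -> M a <= fr) /\
  (forall a b, 6 * Z <= a -> 6 * Z <= b -> M a != 0 -> M a = M b -> a = b).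

(** Dictionary cells are written once, from 0 to a name; facts about nonzero cells therefore survive
    later insertions. *)
Definition grows (M M' : nat -> nat) :=
  forall a, 6 * Z <= a -> M a != 0 -> M' a = M a.

Lemma grows_trans M1 M2 M3 : grows M1 M2 -> grows M2 M3 -> grows M1 M3.
Proof. by move=> h1 h2 a ha na; rewrite h2 ?h1. Qed.

Lemma dict_low M M' fr :
  (forall a, 6 * Z <= a -> M' a = M a) -> dict M fr -> dict M' fr.
Proof.
move=> eq [bd inj]; split=> [a ha|a b ha hb]; first by rewrite eq ?bd.
by rewrite !eq //; exact: inj.
Qed.

(** A fresh name exceeds all stored ones, so the dictionary stays injective; letters and substrings
    share one supply of names. *)
Lemma wp_lookup E M T (Q : state -> Prop) a fr :
  E va = a -> E vfr = fr -> dict M fr -> 6 * Z <= a -> fr.+1 < 2 ^ w ->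
  (forall (v : nat) (M' : nat -> nat) fr', v != 0 -> M' a = v ->
     dict M' fr' -> fr <= fr' <= fr.+1 ->
     grows M M' -> (forall b : nat, b != a -> M' b = M b) ->
     Q (State (upd (upd E vfr fr') vv v) M' T)) ->
  wp w lookup Q (State E M T).
Proof.
move=> Ea Ef [bd inj] ha hf HQ; rewrite /lookup; asg.
eapply wp_if; [ev| |] => Ev.
  rewrite /wp /= -(upd_id Ef); apply: HQ => //; lia.
asg; asg; sto.
rewrite /= ![upd (upd _ vv _) vfr _]upd_swap // !upd_upd.
apply: HQ; rewrite ?upd_same //=; try lia.
- split=> [b hb|b c hb hc]; rewrite /upd.
    by case: eqP => _; [|have := bd b hb]; lia.
  have := bd b hb; have := bd c hc.
  by case: (b =P a) => [->|_]; case: (c =P a) => [->|_] // ? ? ? ?; [lia|lia|exact: inj].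
- by move=> b hb nb; rewrite upd_other //; apply: contraNneq nb => ->; rewrite Ev.
- by move=> b hb; rewrite upd_other.
Qed.

Lemma wp_window_start E M T (Q : state -> Prop) p g :
  consts E -> E vp = p -> E vg = g -> p < g <= n ->
  Q (State (upd E vlo (maxn p (g - K))) M T) ->
  wp w window_start Q (State E M T).
Proof.
move=> cE Ep Eg pg HQ; have := z_le_Z => ?; rewrite /window_start; asg.
eapply (@wp_cond_asgn w _ _ _ _ _ _ _ (p + K < g)); [by ev|by move=> pK; ev|].
by have -> : (if p + K < g then g - K else p) = maxn p (g - K) by case: ifP; lia.
Qed.

Definition input_ram M := forall i, 1 <= i <= n -> M (i + 2) = letter S i.

(** Records the two edges behind a rank. The dictionary cells involved are nonzero, hence stability
    under [grows]; injectivity of the dictionary then recovers the letter from its rank. *)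
Definition ranked (M : nat -> nat) (i : nat) :=
  let v := M (H + letter S i %/ 2) in
  [/\ v != 0, M (5 * Z + i) != 0
    & M (5 * Z + i) = M (6 * Z + v * Z + letter S i %% 2)].

Lemma ranked_grows M M' i :
  grows M M' -> M' (5 * Z + i) = M (5 * Z + i) -> ranked M i -> ranked M' i.
Proof.
move=> gr E [v0 r0 rE]; rewrite /ranked.
have Ev : M' (H + letter S i %/ 2) = M (H + letter S i %/ 2) by apply: gr => //; lia.
rewrite Ev E; split=> //; rewrite rE; apply/esym/gr; last by rewrite -rE.
by lia.
Qed.

Lemma wp_rank_letters E M T (Q : state -> Prop) :
  consts E -> input_ram M -> (forall a, n + 2 < a -> M a = 0) ->
  (forall E' M', consts E' -> (forall a, a < 5 * Z -> M' a = M a) ->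
     E' vfr <= 2 * n -> dict M' (E' vfr) -> (forall i, 1 <= i <= n -> ranked M' i) ->
     Q (State E' M' (T + n))) ->
  wp w rank_letters Q (State E M T).
Proof.
move=> cE inp M0 HQ; have := z_le_Z => zZ; rewrite /rank_letters; asg; asg.
eapply (@wp_repeat w (fun j s => [/\ consts (env s), env s vi = j,
  ticks s = T + j, forall a, a < 5 * Z -> ram s a = M a &
  [/\ env s vfr <= 2 * j, dict (ram s) (env s vfr) &
      forall i, 1 <= i <= j -> ranked (ram s) i]])); first by ev.
- by lia.
- rewrite /=; split=> //; first by do 2 apply: consts_upd => //.
  + by rewrite addn0.
  + split=> //; last by move=> i; lia.
    by split=> [a ha|a b ha hb]; rewrite (M0 a) //; lia.
- move=> j E1 M1 T1 jn [/= c1 Ei ET low [frj dM rk]]; asg.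
  have jn1 : 1 <= j + 1 <= n by lia.
  have xW := letter_lt jn1; have Mx : M1 (j + 1 + 2) = letter S (j + 1).
    by rewrite low ?inp //; lia.
  set x := letter S (j + 1) in xW Mx; have xE : letter S (j + 1) = x by []; clearbody x.
  asg; asg; sq.
  have fr1 : E1 vfr < 2 * n by lia.
  eapply wp_lookup; [lk|lk|exact: dM|lia|lia|].
  move=> v M2 fr2 v0 Mv d2 fr2b gr2 fM2.
  have vfr2 : v <= fr2 by rewrite -Mv; apply: (proj1 d2); lia.
  have n2 : 2 * n <= Z by lia.
  have vZb : v * Z <= Z * Z by rewrite leq_mul2r; lia.
  have x2 : x %% 2 < 2 by rewrite ltn_mod.
  asg; sq.
  eapply wp_lookup; [lk|lk|exact: d2|lia|lia|].
  move=> r M3 fr3 r0 Mr d3 fr3b gr3 fM3; sto.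
  have Mv3 : M3 (H + x %/ 2) = v by rewrite gr3 ?Mv //; lia.
  have gr13 : grows M1 M3 by apply: grows_trans gr2 gr3.
  pose M4 := upd M3 (5 * Z + (j + 1)) r.
  have E4 a : a != 5 * Z + (j + 1) -> M4 a = M3 a by move=> h; rewrite /M4 upd_other.
  have gr34 : grows M3 M4 by move=> a ha _; rewrite E4 //; lia.
  rewrite -/M4; split=> /=.
  + by repeat apply: consts_upd => //.
  + by rewrite /upd /= addn1.
  + by rewrite ET addnS.
  + by move=> a ha; rewrite E4 ?fM3 ?fM2 ?low //; lia.
  + rewrite /upd /=; split; first lia.
      by apply: dict_low d3 => a ha; rewrite E4 //; lia.
    move=> i ij; have [ij'|->] : i <= j \/ i = j + 1 by lia.
      apply: (ranked_grows (M := M1)); [exact: grows_trans gr13 gr34| |].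
        by rewrite E4 ?fM3 ?fM2 //; lia.
      by apply: rk; lia.
    rewrite /ranked xE E4; last by lia.
    rewrite Mv3 {1 2}/M4 upd_same E4; last by lia.
    by rewrite Mr.
- by move=> [E1 M1 T1] [/= c1 _ -> low [h1 h2 h3]]; apply: HQ.
Qed.

(** * Choice of the candidates *)

Section Select.
Variable P : nat.
Notation cd := (code S w sg P).

Definition covers (i : nat) (gs : seq nat) :=
  forall j, 1 <= j <= i -> j \in gs \/
    [/\ P <= n, K <= j & exists j', [/\ j' \in gs, K <= j' & cd j' = cd j]].

(** [covers] leads to the attractor property; the distinct codes bound the number of candidates from
    K on by P. *)
Definition selection (i : nat) (gs : seq nat) :=
  [/\ path ltn 0 gs, all (leq^~ i) gs, covers i gs
    & P <= n -> uniq [seq cd j | j <- gs & K <= j]].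

Lemma selection_skip i gs j' : selection i gs -> P <= n -> K <= i.+1 ->
  j' \in gs -> K <= j' -> cd j' = cd i.+1 -> selection i.+1 gs.
Proof.
move=> [ps al cv un] Pn Ki jin Kj Ecd; split=> //.
  by apply: sub_all al => x /=; lia.
move=> j ji; have [ji'|->] : j <= i \/ j = i.+1 by lia.
  by apply: cv; lia.
by right; split=> //; exists j'.
Qed.

Lemma selection_rcons i gs : selection i gs ->
  (P <= n -> K <= i.+1 -> {in gs, forall j, K <= j -> cd j != cd i.+1}) ->
  selection i.+1 (rcons gs i.+1).
Proof.
move=> [ps al cv un] new; split.
- rewrite rcons_path ps /=; have := mem_last 0 gs; rewrite inE => /orP[/eqP->//|].
  by move/(allP al); rewrite ltnS.
- by rewrite all_rcons leqnn; apply: sub_all al => x /=; lia.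
- move=> j ji; have [ji'|->] : j <= i \/ j = i.+1 by lia.
    have [|jin|[h1 h2 [j' [h3 h4 h5]]]] := cv j; first by lia.
      by left; rewrite mem_rcons inE jin orbT.
    by right; split=> //; exists j'; rewrite mem_rcons inE h3 orbT.
  by left; rewrite mem_rcons inE eqxx.
- move=> Pn; rewrite filter_rcons; case: ifP => Ki; last exact: un.
  rewrite map_rcons rcons_uniq un // andbT; apply/mapP => -[j].
  by rewrite mem_filter => /andP[Kj /(new Pn Ki)/(_ Kj)/eqP h] /esym.
Qed.

Lemma selection_lt0 i gs : selection i gs -> 0 \notin gs.
Proof. by move=> [/(order_path_min ltn_trans)/allP h _ _ _]; apply/negP => /h. Qed.

Lemma selection_size i gs : selection i gs -> size gs <= i.
Proof.
move=> sl; have [ps al _ _] := sl.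
have -> : i = size (iota 1 i) by rewrite size_iota.
apply: uniq_leq_size => [|x xin].
  by move: (path_sorted ps); apply: sorted_uniq; [exact: ltn_trans|exact: ltnn].
rewrite mem_iota; have := allP al _ xin; have := selection_lt0 sl.
by case: x xin => [->//|x] _ _; lia.
Qed.

Hypotheses (P_gt0 : 0 < P) (P_le : P <= n * n.+1).

Lemma code_lt_Z i : cd i < Z.
Proof. by have := code_lt S w sg P_gt0 i; rewrite ZE zE; lia. Qed.

Definition listed (M : nat -> nat) (gs : seq nat) :=
  forall t, t < size gs -> M (Z + t.+1) = nth 0 gs t.

Lemma wp_select E M T (Q : state -> Prop) :
  consts E -> E vP = P -> input_ram M -> (forall a, Z <= a < 3 * Z -> M a = 0) ->
  (forall E' M' gs, consts E' -> E' vm = size gs -> selection n gs ->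
     (forall a, ~~ (Z <= a < 3 * Z) -> M' a = M a) ->
     (forall t, t <= (size gs).+1 -> M' (Z + t) = nth 0 (0 :: rcons gs n.+1) t) ->
     Q (State E' M' (T + n))) ->
  wp w select Q (State E M T).
Proof.
move=> cE EP inp M0 HQ; have zZ := z_le_Z; rewrite /select; asg; asg; asg; sq.
(* A marked code has a chosen witness, which justifies skipping a position. The converse, kept
   separately in the invariant, makes the codes of chosen positions distinct. *)
pose fwd (N : nat -> nat) (gs : seq nat) := forall c, c < Z -> N (2 * Z + c) != 0 ->
  exists2 j, j \in gs & K <= j /\ cd j = c.
pose common i gs E1 M1 := [/\ consts E1 /\ E1 vP = P, E1 vi = i /\ E1 vcd = cd i,
  E1 vm = size gs /\ listed M1 gs,
  (forall a, ~~ (Z <= a < 3 * Z) -> M1 a = M a) /\ M1 Z = 0 &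
  selection i gs /\ fwd M1 gs].
eapply (@wp_repeat w (fun i s => exists gs, [/\ ticks s = T + i,
  common i gs (env s) (ram s) &
  {in gs, forall j, K <= j -> ram s (2 * Z + cd j) != 0}])); first by ev.
- by lia.
- exists [::]; split; [by rewrite addn0| |by []]; rewrite /common /= /upd /=.
  split=> //; try by split=> //; apply: M0; lia.
    by split=> //; do 3 apply: consts_upd => //.
  split; last by move=> c cZ; rewrite M0; lia.
  by split=> // j; lia.
- move=> i E1 M1 T1 iN [gs [/= ET [[c1 EP1] [Ei Ec] [Em ls] [fr MZ] [sl fw]] bw]].
  have szi := selection_size sl.
  have Mx : M1 (i + 1 + 2) = letter S i.+1.
    rewrite fr; first by rewrite addn1 inp.
    by lia.
  asg; sq; eapply (@wp_asgn w _ _ _ _ _ _ (cd i.+1)).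
    etransitivity; first eapply eval_mod.
    + eapply eval_addm; [eapply eval_mulm; [ev|ev]|ev].
    + by ev.
    by [].
  set c := cd i.+1; have cZ : c < Z by exact: code_lt_Z.
  asg; sq.
  eapply (@wp_cond_asgn w _ _ _ _ _ _ _ (n < P)); [by ev|by move=> _; ev|].
  set f := if n < P then 0 else M1 (2 * Z + c).
  sq.
  (* Between choosing and marking, the table may lag behind at position [i.+1] alone. *)
  apply: (@wp_conseq w _ (fun s => exists gs', [/\ ticks s = T + i.+1,
    common i.+1 gs' (env s) (ram s),
    {in gs', forall j, K <= j -> j != i.+1 -> ram s (2 * Z + cd j) != 0} &
    K <= i.+1 -> exists2 j, j \in gs' & K <= j /\ cd j = c])).
    eapply wp_if; [by ev| |] => f0.
      have [Pn Mc] : P <= n /\ M1 (2 * Z + c) != 0.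
        by move: f0; rewrite /f; case: ltnP.
      have [j jin [Kj Ej]] := fw c cZ Mc.
      have Ki : K <= i.+1 by have [_ /allP/(_ _ jin) h _ _] := sl; lia.
      exists gs; split; rewrite /= /common /upd /=.
      + by rewrite ET addnS.
      + split=> //; [|by rewrite addn1|by split=> //; apply: selection_skip Ej].
        by split=> //; repeat apply: consts_upd => //.
      + by move=> j' j'in Kj' _; apply: bw.
      + by move=> _; exists j.
    asg; sto.
    exists (rcons gs i.+1); split; rewrite /= /common.
    + by rewrite ET addnS.
    + split.
      * by split=> //; repeat apply: consts_upd => //.
      * by rewrite /upd /= addn1.
      * rewrite size_rcons; split=> [|t]; first by rewrite /upd /= addn1.
        rewrite size_rcons ltnS nth_rcons => tm.
        have [->|tm'] := eqVneq t (size gs); first by rewrite ltnn addn1 upd_same addn1.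
        have tlt : t < size gs by lia.
        by rewrite tlt upd_other ?ls //; lia.
      * by split=> [a ha|]; rewrite upd_other ?MZ ?fr //; lia.
      * split; last first.
          move=> c' c'Z; rewrite upd_other; last by lia.
          by move=> /(fw _ c'Z)[j jin h]; exists j; rewrite // mem_rcons inE jin orbT.
        apply: selection_rcons => // Pn Ki j jin Kj; apply/eqP => Ej.
        by move: f0; rewrite /f ltnNge Pn /= /c -Ej => /eqP; apply/negP; exact: bw.
    + move=> j; rewrite mem_rcons inE => /orP[/eqP->|jin] Kj; first by rewrite eqxx.
      by move=> _; rewrite upd_other ?bw //; have := code_lt_Z j; lia.
    + by move=> Ki; exists i.+1; rewrite ?mem_rcons ?inE ?eqxx.
  move=> [E2 M2 T2] [gs' [/= ET2 [[c2 EP2] [Ei2 Ec2] [Em2 ls2] [fr2 MZ2] [sl2 fw2]] bw2 new]].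
  have szi2 := selection_size sl2.
  eapply wp_if; [by ev| |] => iK.
    rewrite /wp /=; exists gs'; split=> // j jin Kj; apply: (bw2 j jin Kj).
    have [_ /allP/(_ _ jin) /= ji _ _] := sl2.
    by move: iK; rewrite eqb0 negbK => iK; apply/eqP; lia.
  sto; exists gs'; have Ki : K <= i.+1 by move/eqP: iK; rewrite eqb0 -leqNgt.
  split=> //=; last first.
    move=> j jin Kj; rewrite /upd; case: (_ + cd j =P _) => // ne; apply: bw2 => //.
    by apply/eqP => ji; apply: ne; rewrite ji.
  split=> //=.
  + by split=> // t tm; rewrite upd_other ?ls2 //; lia.
  + by split=> [a ha|]; rewrite upd_other ?MZ2 ?fr2 //; have := code_lt_Z i.+1; lia.
  + split=> // c' c'Z; rewrite /upd; case: (_ + c' =P _) => [ee _|_]; last exact: fw2.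
    have -> : c' = c by move/addnI: ee.
    exact: new.
- move=> [E1 M1 T1] [gs [/= ET [[c1 EP1] [Ei Ec] [Em ls] [fr MZ] [sl fw]] bw]].
  have szi := selection_size sl.
  sto; rewrite ET; apply: (HQ _ _ gs) => //.
    by move=> a ha; rewrite upd_other ?fr //; lia.
  move=> t tm; have [->|tm'] := eqVneq t (size gs).+1.
    by rewrite /= nth_rcons ltnn eqxx -(addn1 (size gs)) upd_same addn1.
  rewrite upd_other; last by lia.
  case: t tm tm' => [|t] tm tm' /=; first by rewrite addn0.
  by rewrite nth_rcons; have tl : t < size gs; [lia|rewrite tl ls].
Qed.

End Select.

Lemma wp_capped_power E M T (Q : state -> Prop) :
  consts E -> sg <= n.+1 ->
  Q (State (upd E vP (iter K (fun P => if n < P then P else P * sg) 1)) M (T + K)) ->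
  wp w capped_power Q (State E M T).
Proof.
move=> cE sgn HQ; have zZ := z_le_Z; rewrite /capped_power; asg.
have Zs := Z_split.
set f := fun P => if n < P then P else P * sg.
eapply (@wp_repeat w (fun j s => s = State (upd E vP (iter j f 1)) M (T + j))).
- by ev.
- by lia.
- by rewrite addn0.
- move=> j E1 M1 T1 jK [-> -> ->]; set P := iter j f 1.
  have bd : P <= n -> P * sg <= n * z by move=> Pn; apply: leq_mul => //; lia.
  eapply wp_if; [by ev| |] => c; last first.
    have Pn : P <= n by move/eqP: c; rewrite eqb0 -leqNgt.
    have {}bd := bd Pn; asg.
    by rewrite upd_upd iterS -/P /f ltnNge Pn addnS.
  by move: c; rewrite eqb0 negbK => c; rewrite /wp iterS -/P /f c addnS.
- by move=> s ->.
Qed.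

(** * Names of substrings *)

Definition nadr (s e : nat) := 4 * Z + s * z + e.

Lemma nadr_lt s e : s <= n -> e <= n -> nadr s e < 5 * Z.
Proof.
move=> sn en; have : s * z <= n * z by rewrite leq_mul2r sn orbT.
by rewrite /nadr; have := Z_split; have := z_le_Z; lia.
Qed.

(** Rows are [z = n + 4] cells apart and use offsets up to n only. *)
Lemma nadr_apart s s0 e :
  s != s0 -> e <= n -> ~~ (4 * Z + s0 * z <= nadr s e <= 4 * Z + s0 * z + n).
Proof.
rewrite /nadr neq_ltn => /orP[lt|lt] en.
  by have : s.+1 * z <= s0 * z; [rewrite leq_mul2r lt orbT|rewrite mulSn; lia].
by have : s0.+1 * z <= s * z; [rewrite leq_mul2r lt orbT|rewrite mulSn; lia].
Qed.

Definition named (M : nat -> nat) (s e : nat) :=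
  M (nadr s e) != 0 /\
  M (nadr s e) =
    M (6 * Z + (if e == s then 0 else M (nadr s e.-1)) * Z + M (5 * Z + e)).

Definition row (M : nat -> nat) (s : nat) :=
  forall e, s <= e < minn n.+1 (s + K) -> named M s e.

Lemma named_grows M M' s e :
  grows M M' -> M' (nadr s e) = M (nadr s e) ->
  (e != s -> M' (nadr s e.-1) = M (nadr s e.-1)) -> M' (5 * Z + e) = M (5 * Z + e) ->
  named M s e -> named M' s e.
Proof.
move=> gr E1 E2 E3 [nz nE]; split; first by rewrite E1.
have -> : (if e == s then 0 else M' (nadr s e.-1)) =
          (if e == s then 0 else M (nadr s e.-1)).
  by case: eqVneq E2 => // _ ->.
rewrite E1 E3 nE; apply/esym/gr; first lia.
by rewrite -nE.
Qed.

Definition row_frame (s : nat) (M M' : nat -> nat) :=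
  forall a, a < 6 * Z -> ~~ (4 * Z + s * z <= a <= 4 * Z + s * z + n) -> M' a = M a.

Lemma row_preserved s s0 M M' : s != s0 -> s <= n -> s0 <= n ->
  grows M M' -> row_frame s0 M M' -> row M s -> row M' s.
Proof.
move=> ne sn s0n gr fr rw e se; have zZ := z_le_Z; have Zs := Z_split.
have h e' : e' <= n -> M' (nadr s e') = M (nadr s e').
  move=> e'n; apply: fr; last exact: nadr_apart.
  by have := nadr_lt sn e'n; lia.
apply: named_grows (rw e se) => // [|_|]; [by apply: h; lia..|].
apply: fr; first lia.
by have := nadr_lt s0n (leqnn n); rewrite /nadr; lia.
Qed.

Lemma ranked_le M fr i : dict M fr -> ranked M i -> M (5 * Z + i) <= fr.
Proof. by move=> [bd _] [_ _ ->]; apply: bd; lia. Qed.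

Lemma wp_name_row E M T (Q : state -> Prop) s :
  consts E -> E vs = s -> 1 <= s <= n -> dict M (E vfr) -> E vfr + K < Z ->
  (forall i, 1 <= i <= n -> ranked M i) ->
  (forall E' M', dict M' (E' vfr) -> E' vfr <= E vfr + K -> grows M M' ->
     row_frame s M M' -> row M' s ->
     Q (State E' M' (T + (minn n.+1 (s + K) - s)))) ->
  wp w name_row Q (State E M T).
Proof.
move=> cE Es sn dM frZ rk HQ; have zZ := z_le_Z; have Zs := Z_split.
rewrite /name_row; asg; sq.
eapply (@wp_cond_asgn w _ _ _ _ _ _ _ (n + 1 < s + K)); [by ev|by move=> _; ev|].
have -> : (if n + 1 < s + K then n + 1 else s + K) = minn n.+1 (s + K).
  by case: ifP; lia.
set hi := minn _ _; have hiP : s < hi <= n.+1 by rewrite /hi; lia.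
have hiK : hi <= s + K by rewrite /hi geq_minr.
asg; asg.
have sz : s * z <= n * z by rewrite leq_mul2r; lia.
eapply (@wp_repeat w (fun j s' => [/\ consts (env s') /\ env s' vs = s,
  ticks s' = T + j, env s' ve = s + j /\
    env s' vv = (if j == 0 then 0 else ram s' (nadr s (s + j.-1))),
  [/\ dict (ram s') (env s' vfr), env s' vfr <= E vfr + j,
      grows M (ram s') & row_frame s M (ram s')] &
  forall e, s <= e < s + j -> named (ram s') s e])).
- by ev.
- by lia.
- rewrite /upd /= !addn0; split=> //; last by move=> e; lia.
  by split=> //; repeat apply: consts_upd => //.
- move=> j E1 M1 T1 jl [/= [c1 Es1] ET [Ee Ev] [d1 fr1 gr1 rf1] nm1].
  have en : 1 <= s + j <= n by lia.
  have rk1 i : 1 <= i <= n -> ranked M1 i.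
    by move=> hi'; apply: ranked_grows (rk i hi') => //; apply: rf1; lia.
  have rle : M1 (5 * Z + (s + j)) <= E1 vfr by apply: ranked_le d1 (rk1 _ en).
  set u := (if _ then _ else _) in Ev.
  have uE : (if j == 0 then 0 else M1 (nadr s (s + j.-1))) = u by [].
  clearbody u.
  have vle : u <= E1 vfr.
    rewrite -uE; case: eqVneq => // j0.
    have [|_ ->] := nm1 (s + j.-1); first lia.
    by apply: (proj1 d1); lia.
  have vZ' : u * Z <= Z * Z by rewrite leq_mul2r; lia.
  asg; sq.
  eapply wp_lookup; [lk|lk|exact: d1|lia|lia|].
  move=> v M2 fr2 v0 Mv d2 fr2b gr2 fM2; sto; asg.
  have na5 := nadr_lt (proj2 (andP sn)) (proj2 (andP en)).
  pose M3 := upd M2 (nadr s (s + j)) v; rewrite -/(nadr s (s + j)) -/M3.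
  have E3 a : a != nadr s (s + j) -> M3 a = M2 a by move=> h; rewrite /M3 upd_other.
  have E2 a : a < 6 * Z -> M2 a = M1 a by move=> h; rewrite fM2 //; lia.
  have gr23 : grows M2 M3 by move=> a ha _; rewrite E3 //; lia.
  split=> /=.
  + by rewrite /upd /=; split=> //; repeat apply: consts_upd => //.
  + by rewrite ET addnS.
  + by rewrite /upd /= addn1 addnS /M3 upd_same.
  + rewrite /upd /=; split; [|lia| |].
    * by apply: dict_low d2 => a ha; rewrite E3 //; lia.
    * exact: grows_trans (grows_trans gr1 gr2) gr23.
    * move=> a ha hb; rewrite E3 ?E2 ?rf1 //; move: hb; rewrite /nadr; lia.
  + have low e : e < s + j -> M3 (nadr s e) = M1 (nadr s e).
      by move=> h; rewrite E3 ?E2 //; rewrite /nadr; rewrite /nadr in na5; lia.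
    have low5 e : e <= n -> M3 (5 * Z + e) = M1 (5 * Z + e).
      by move=> h; rewrite E3 ?E2 //; lia.
    move=> e ej; have [ej'|->] : e < s + j \/ e = s + j by lia.
      apply: (named_grows (M := M1)); [exact: grows_trans gr2 gr23|exact: low| | |].
      * by move=> _; apply: low; lia.
      * by apply: low5; lia.
      * by apply: nm1; lia.
    have u1 : (if s + j == s then 0 else M3 (nadr s (s + j).-1)) = u.
      rewrite -uE; have -> : (s + j == s) = (j == 0) by lia.
      by case: eqVneq => // j0; rewrite low; [congr (M1 (nadr _ _))|]; lia.
    rewrite /named u1 low5; last by lia.
    by rewrite {1 2}/M3 upd_same E3 ?Mv //; lia.
- move=> [E1 M1 T1] [/= _ -> _ [d1 fr1 gr1 rf1] nm1]; apply: HQ => //; first lia.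
  by move=> e he; apply: nm1; rewrite subnKC //; lia.
Qed.

Lemma pair_inj u r u' r' :
  r < Z -> r' < Z -> 6 * Z + u * Z + r = 6 * Z + u' * Z + r' -> u = u' /\ r = r'.
Proof.
move=> rZ rZ' E6; have E : u * Z + r = u' * Z + r' by [lia]; have Z0 : 0 < Z by lia.
have := congr1 (divn^~ Z) E; rewrite !divnMDl // !divn_small // !addn0 => Eu.
by split=> //; move: E; rewrite Eu => /addnI.
Qed.

Section Names.
Variables (M : nat -> nat) (fr : nat).
Hypotheses (dM : dict M fr) (frZ : fr < Z).
Hypothesis rk : forall i, 1 <= i <= n -> ranked M i.

Lemma rank_eq i j : 1 <= i <= n -> 1 <= j <= n ->
  M (5 * Z + i) = M (5 * Z + j) <-> letter S i = letter S j.
Proof.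
move=> iN jN; have [vi ri Ei] := rk iN; have [vj rj Ej] := rk jN.
split=> [E|E]; last by rewrite Ei Ej E.
have zZ := z_le_Z.
have x2 x : x %% 2 < Z by apply: (@ltn_trans 2); [rewrite ltn_mod|lia].
have : 6 * Z + M (H + letter S i %/ 2) * Z + letter S i %% 2 =
       6 * Z + M (H + letter S j %/ 2) * Z + letter S j %% 2.
  by apply: (proj2 dM); rewrite -?Ei -?Ej //; lia.
move=> E'; have [Ev Em] := pair_inj (x2 _) (x2 _) E'.
have : H + letter S i %/ 2 = H + letter S j %/ 2.
  by apply: (proj2 dM) => //; lia.
by move/addnI => Ed; rewrite (divn_eq (letter S i) 2) Ed Em -divn_eq.
Qed.

(** Induction on the length: equal names sit at equal addresses, which exposes equal parents and
    equal last letters. As stored names are nonzero, no nonempty prefix is confused with the root,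
    so the lengths agree. *)
Lemma name_eq s e s' e' : 1 <= s -> 1 <= s' -> row M s -> row M s' ->
  s <= e < minn n.+1 (s + K) -> s' <= e' < minn n.+1 (s' + K) ->
  M (nadr s e) = M (nadr s' e') <->
  e - s = e' - s' /\ forall r, r <= e - s -> letter S (s + r) = letter S (s' + r).
Proof.
move=> s1 s1' rw rw'.
have rlt i : 1 <= i <= n -> M (5 * Z + i) < Z.
  by move=> iN; have := ranked_le dM (rk iN); lia.
elim: {e}(e - s) {-2}e (erefl (e - s)) e' => [|d IH] e ed e' se se';
    have [nz nE] := rw e se; have [nz' nE'] := rw' e' se'; have zZ := z_le_Z;
    have en : 1 <= e <= n by [lia]; have en' : 1 <= e' <= n by [lia].
  have ee : e = s by lia.
  rewrite ee eqxx in nE; rewrite ee in en nz *.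
  split=> [E|[E El]].
    have := proj2 dM (6 * Z + 0 * Z + M (5 * Z + s)) _ _ _ _ (etrans (etrans (esym nE) E) nE').
    rewrite -nE => /(_ _ _ nz) h.
    have [Eu Er] := pair_inj (rlt _ en) (rlt _ en') (h ltac:(lia) ltac:(lia)).
    have es' : e' = s'.
      apply/eqP; apply: contraT => ne; move: Eu; rewrite (negPf ne).
      by have [|/eqP nz1 _ /esym//] := rw' e'.-1; first lia.
    rewrite es' !subnn; split=> // r; rewrite leqn0 => /eqP->.
    by rewrite !addn0 -es'; apply/rank_eq.
  have es' : e' = s' by lia.
  have := El 0; rewrite !addn0 => /(_ isT) Es.
  rewrite nE nE' es' eqxx; congr M; congr (_ + _).
  by apply/rank_eq => //; rewrite -es'.
have ne : e != s by lia.
have sp : s <= e.-1 < minn n.+1 (s + K) by lia.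
have [nzp _] := rw e.-1 sp.
rewrite (negPf ne) in nE.
split=> [E|[E El]].
  have := proj2 dM (6 * Z + M (nadr s e.-1) * Z + M (5 * Z + e)) _ _ _ _ (etrans (etrans (esym nE) E) nE').
  rewrite -nE => /(_ _ _ nz) h.
  have [Eu Er] := pair_inj (rlt _ en) (rlt _ en') (h ltac:(lia) ltac:(lia)).
  have ne' : e' != s'.
    apply/eqP => es'; move: Eu; rewrite es' eqxx => Eu.
    by rewrite Eu in nzp.
  rewrite (negPf ne') in Eu.
  have := proj1 (IH e.-1 ltac:(lia) e'.-1 sp ltac:(lia)) Eu => -[E3 E4].
  split=> [|r]; first lia.
  rewrite leq_eqVlt => /orP[/eqP->|rl]; last by apply: E4; lia.
  have -> : s + (e - s) = e by lia.
  have -> : s' + (e - s) = e' by lia.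
  exact/rank_eq.
have ne' : e' != s' by lia.
rewrite (negPf ne') in nE'.
rewrite nE nE'; congr M; congr (_ + _ * _ + _).
  by apply/(IH e.-1); [lia|lia|lia|split=> [|r rl]; [lia|apply: El; lia]].
apply/rank_eq => //; have := El (e - s) (leqnn _).
by have -> : s + (e - s) = e by [lia]; have -> : s' + (e - s) = e' by lia.
Qed.

End Names.

(** * Counter updates over a rectangle *)

Section Sweep.
Variable name : nat * nat -> nat.

(* One counter update of [sweep]: add [d] modulo 2 ^ w, and remember whether a
   counter vanished. *)
Definition bump (d : nat) (fb : (nat -> nat) * bool) (q : nat * nat) :=
  let v := (fb.1 (name q) + d) %% 2 ^ w in
  (upd fb.1 (name q) v, fb.2 && (v != 0)).

Lemma foldl_bump_incr f b l :
  (forall c, f c + size l < 2 ^ w) ->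
  forall c, (foldl (bump 1) (f, b) l).1 c = f c + count (fun q => name q == c) l.
Proof.
elim/last_ind: l => [|l q IH] lt c; first by rewrite addn0.
have {IH} IH := IH _ _; rewrite -cats1 foldl_cat count_cat /= addn0.
have lt' c' : f c' + size l < 2 ^ w by have := lt c'; rewrite size_rcons; lia.
rewrite /upd; case: eqVneq => [->|ne]; rewrite IH //; last first.
  by rewrite !addn0.
rewrite modn_small ?addnA //.
have := count_size (fun q0 => name q0 == name q) l; have := lt (name q).
by rewrite size_rcons; lia.
Qed.

(** No counter is lowered below 0, so it can vanish only at its last decrement; the flag, cleared at
    once when that happens, thus reports on the final values. *)
Lemma foldl_bump_decr f b l :
  (forall c, count (fun q => name q == c) l <= f c < 2 ^ w) ->
  (forall c, (foldl (bump (2 ^ w - 1)) (f, b) l).1 c =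
     f c - count (fun q => name q == c) l) /\
  (foldl (bump (2 ^ w - 1)) (f, b) l).2 =
    b && all (fun q => count (fun q' => name q' == name q) l < f (name q)) l.
Proof.
elim/last_ind: l => [|l q IH] lt; first by split=> [c|]; rewrite ?subn0 ?andbT.
have [|E1 E2] := IH.
  by move=> c; have := lt c; rewrite -cats1 count_cat; lia.
rewrite -cats1 foldl_cat /= E1.
have ltq := lt (name q); rewrite -cats1 count_cat /= eqxx addn0 [nat_of_bool true]/= in ltq.
have Ev : (f (name q) - count (fun q0 => name q0 == name q) l + (2 ^ w - 1)) %% 2 ^ w
   = f (name q) - (count (fun q0 => name q0 == name q) l + 1).
  move: (count _ l) ltq => u ltq; rewrite pred_mod //; lia.
rewrite Ev; split=> [c|].
  rewrite count_cat /= addn0 /upd; case: eqVneq => [->|ne] //=.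
  by rewrite E1 addn0.
rewrite E2 all_cat /= count_cat /= eqxx andbT -andbA; congr andb.
rewrite !addn0 subn_eq0 -ltnNge; case: ltnP => [lq|]; rewrite ?andbF // !andbT.
apply: eq_in_all => q' _; rewrite count_cat /= addn0.
by case: eqVneq => [<-|_]; [lia|rewrite addn0].
Qed.

Lemma wp_sweep E M T (Q : state -> Prop) p g x d f b :
  consts E -> E vp = p -> E vg = g -> E vx = x -> E vd = d ->
  p < g <= n -> g < x <= n.+1 ->
  (forall q, q \in rect K p g x -> M (nadr q.1 q.2) = name q /\ name q < Z) ->
  (forall c, c < Z -> M (3 * Z + c) = f c) -> (E vfl != 0) = b ->
  (forall E' M' T', let fb := foldl (bump d) (f, b) (rect K p g x) in
     (E' vfl != 0) = fb.2 -> (forall c, c < Z -> M' (3 * Z + c) = fb.1 c) ->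
     (forall a, ~~ (3 * Z <= a < 4 * Z) -> M' a = M a) ->
     T' <= T + minn K (g - p) * (minn K (x - g)).+1 ->
     Q (State E' M' T')) ->
  wp w sweep Q (State E M T).
Proof.
move=> cE Ep Eg Ex Ed pg gx nmM cM Efl HQ; have zZ := z_le_Z; have Zs := Z_split.
pose rowl s := [seq (s, e) | e <- iota g (minn x (s + K) - g)].
pose st fb (E1 M1 : nat -> nat) := [/\ (E1 vfl != 0) = fb.2,
  forall c, c < Z -> M1 (3 * Z + c) = fb.1 c &
  forall a, ~~ (3 * Z <= a < 4 * Z) -> M1 a = M a].
pose rd E1 := [/\ consts E1, E1 vg = g, E1 vx = x & E1 vd = d].
rewrite /sweep; sq; eapply wp_window_start; [exact: cE|exact: Ep|exact: Eg|exact: pg|].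
rewrite /rect in nmM HQ; set lo := maxn _ _ in nmM HQ *.
have loP : p <= lo < g by rewrite /lo; lia.
(* Every start s in range satisfies [g < s + K], so no row is empty and the machine subtraction
   [vhi - vg] does not wrap. *)
have loK : g < lo.+1 + K by rewrite /lo; lia.
asg.
eapply (@wp_repeat w (fun j s => [/\ rd (env s), env s vs = lo + j,
  st (foldl (bump d) (f, b) (flatten [seq rowl s | s <- iota lo.+1 j])) (env s) (ram s) &
  ticks s <= T + j * (minn K (x - g)).+1])).
- by ev.
- by lia.
- rewrite /upd /= !addn0; split=> //.
  by split=> //; repeat apply: consts_upd => //.
- move=> j E1 M1 T1 jl [/= [c1 Eg1 Ex1 Ed1] Es1 st1 ET1].
  set s := lo + j + 1; asg; asg; sq.
  eapply (@wp_cond_asgn w _ _ _ _ _ _ _ (x < s + K)); [by ev|by move=> _; ev|].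
  have -> : (if x < s + K then x else s + K) = minn x (s + K) by case: ifP; lia.
  set hi := minn x (s + K); have hiP : g < hi <= n.+1 by rewrite /hi /s; lia.
  have hiK : hi - g <= minn K (x - g) by rewrite /hi /s; lia.
  asg.
  have sn : s <= n by rewrite /s; lia.
  set acc := foldl _ _ _ in st1.
  eapply (@wp_repeat w (fun i s' => [/\ rd (env s'), env s' vs = s /\ env s' ve = g + i,
    st (foldl (bump d) acc [seq (s, e) | e <- iota g i]) (env s') (ram s') &
    ticks s' <= T1 + 1 + i])).
  + by ev.
  + by lia.
  + rewrite /upd /= !addn0; split=> //; last by rewrite addn1.
    by split=> //; repeat apply: consts_upd => //.
  + move=> i E2 M2 T2 il [/= [c2 Eg2 Ex2 Ed2] [Es2 Ee2] [fl2 cm2 fr2] ET2].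
    have en : g + i <= n by lia.
    have qin : (s, g + i) \in [seq (s, e) | s <- iota lo.+1 (g - lo),
                                          e <- iota g (minn x (s + K) - g)].
      apply/allpairsPdep; exists s, (g + i); rewrite !mem_iota; split=> //.
      * by rewrite /s; lia.
      * by rewrite -/hi; lia.
    have [nq nqZ] := nmM _ qin; rewrite /= in nq nqZ.
    have na := nadr_lt sn en; have na4 : 4 * Z <= nadr s (g + i) by rewrite /nadr; lia.
    have Mn : M2 (nadr s (g + i)) = name (s, g + i) by rewrite fr2 //; lia.
    rewrite /nadr in Mn na na4.
    have sz : s * z <= n * z by rewrite leq_mul2r sn orbT.
    asg; have Mc := cm2 _ nqZ.
    set fb2 := foldl _ _ _ in fl2 cm2 Mc.
    sq; eapply wp_asgn; first by (eapply eval_addm; [ev|ev]).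
    sto; set v := _ %% _.
    have Efb : foldl (bump d) acc [seq (s, e) | e <- iota g i.+1] =
               (upd fb2.1 (name (s, g + i)) v, fb2.2 && (v != 0)).
      by rewrite -(addn1 i) iotaD map_cat foldl_cat /= -/fb2.
    have cm3 c : c < Z -> upd M2 (3 * Z + name (s, g + i)) v (3 * Z + c) =
        upd fb2.1 (name (s, g + i)) v c.
      by move=> cZ; rewrite /upd eqn_add2l; case: eqP => // _; exact: cm2.
    have fr3 a : ~~ (3 * Z <= a < 4 * Z) -> upd M2 (3 * Z + name (s, g + i)) v a = M a.
      by move=> ha; rewrite upd_other ?fr2 //; lia.
    have st3 E3 : (E3 vfl != 0) = fb2.2 && (v != 0) ->
        st (foldl (bump d) acc [seq (s, e) | e <- iota g i.+1]) E3
           (upd M2 (3 * Z + name (s, g + i)) v).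
      by move=> h; rewrite Efb; split.
    sq; eapply wp_if; [by ev| |] => v0.
      apply: wp_skip; asg; split=> /=.
      * by split=> //; repeat apply: consts_upd => //.
      * by rewrite /upd /= -addnA addn1.
      * by apply: st3; rewrite v0 andbT /upd /= fl2.
      * by lia.
    asg; asg; split=> /=.
    * by split=> //; repeat apply: consts_upd => //.
    * by rewrite /upd /= -addnA addn1.
    * by apply: st3; rewrite v0 andbF /upd.
    * by lia.
  + move=> [E2 M2 T2] [/= rd2 [Es2 _] st2 ET2].
    have st3 : st (foldl (bump d) (f, b) (flatten [seq rowl s | s <- iota lo.+1 j.+1])) E2 M2.
      rewrite -(addn1 j) iotaD map_cat flatten_cat foldl_cat -/acc /= cats0.
      by rewrite addSn -addn1 -/s /rowl -/hi.
    split=> //=.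
    * by rewrite Es2 /s -addnA addn1.
    * by rewrite mulSn; lia.
- move=> [E1 M1 T1] [/= _ _ [fl1 cm1 fr1] ET1]; apply: HQ => //.
  have -> : minn K (g - p) = g - lo by rewrite /lo; lia.
  exact: ET1.
Qed.

End Sweep.

(** * Traversal of the candidates between the sentinels 0 and n + 1 *)

Section Candidates.
Variable gs : seq nat.
Hypothesis gs_path : path ltn 0 (rcons gs n.+1).
Notation m := (size gs).
Notation g := (nth 0 (0 :: rcons gs n.+1)).

Lemma g_lt t : t <= m -> g t < g t.+1.
Proof. by move=> tm; have /(pathP 0) h := gs_path; apply: h; rewrite size_rcons ltnS. Qed.

Lemma g_le t : t <= m -> g t <= n.
Proof.
move=> tm; have gm : nth 0 (rcons gs n.+1) m = n.+1 by rewrite nth_rcons ltnn eqxx.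
have := @sorted_ltn_nth _ ltn ltn_trans 0 (0 :: rcons gs n.+1) gs_path.
move=> /(_ t m.+1); rewrite !inE /= size_rcons !ltnS => /(_ (leqW tm) (leqnn _) tm).
by rewrite gm ltnS.
Qed.

Lemma size_gs_le : m <= n.
Proof.
suff h t : t <= m -> t <= g t by apply: leq_trans (h _ (leqnn _)) (g_le (leqnn _)).
by elim: t => // t IH tm; have := IH (ltnW tm); have := g_lt (ltnW tm); lia.
Qed.

Definition listing (M : nat -> nat) := forall t, t <= m.+1 -> M (Z + t) = g t.

Definition mgap (t : nat) := minn K (g t.+1 - g t).

Definition ids_ready (M : nat -> nat) (t : nat) :=
  forall s i, i < t -> maxn (g i) (g i.+1 - K) < s <= g i.+1 -> row M s.

Lemma wp_name_occurrences E M T (Q : state -> Prop) :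
  consts E -> E vm = m -> E vfr <= 2 * n -> dict M (E vfr) ->
  (forall i, 1 <= i <= n -> ranked M i) -> listing M ->
  (forall E' M' T' fr, consts E' -> E' vm = m -> dict M' fr -> fr < Z ->
     (forall a, a < 4 * Z -> M' a = M a) -> (forall i, 1 <= i <= n -> ranked M' i) ->
     ids_ready M' m -> T' <= T + \sum_(i < m) (1 + mgap i * K.+1) ->
     Q (State E' M' T')) ->
  wp w name_occurrences Q (State E M T).
Proof.
move=> cE Em frn dM rk lst HQ; have zZ := z_le_Z; have Zs := Z_split.
rewrite /name_occurrences; asg.
have mn := size_gs_le.
(* The supply of names: two per letter and at most K per start position. *)
have Zn2 : 2 * n + n * K < Z.
  rewrite Zs; have : n * K <= n * z by rewrite leq_mul2l zE; lia.
  by rewrite zE; lia.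
pose inv fr0 M1 := [/\ dict M1 fr0, (forall a, a < 4 * Z -> M1 a = M a) &
   forall i, 1 <= i <= n -> ranked M1 i].
eapply (@wp_repeat w (fun t s => [/\ consts (env s) /\ env s vm = m, env s vt = t,
  ticks s <= T + \sum_(i < t) (1 + mgap i * K.+1),
  env s vfr <= 2 * n + g t * K /\ inv (env s vfr) (ram s) & ids_ready (ram s) t])).
- by ev.
- by lia.
- rewrite /upd /= big_ord0 addn0; split=> //; split=> //; last lia.
  by apply: consts_upd.
- move=> t E1 M1 T1 tm [/= [c1 Em1] Et ET [frt [d1 low1 rk1]] ids1].
  have Mp : M1 (Z + t) = g t by rewrite low1 ?lst //; lia.
  have Mg : M1 (Z + (t + 1)) = g t.+1 by rewrite addn1 low1 ?lst //; lia.
  have gt1 := g_lt (ltnW tm); have gn := g_le tm.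
  have [p' pE] : {p' | g t = p'} by exists (g t).
  have [g' gE] : {g' | g t.+1 = g'} by exists (g t.+1).
  rewrite !(pE, gE) in Mp Mg gt1 gn frt.
  asg; asg; asg; sq.
  eapply wp_window_start; [by repeat apply: consts_upd => //|lk|lk|lia|].
  set lo := maxn _ _; have loP : p' <= lo < g' by rewrite /lo; lia.
  asg.
  eapply (@wp_repeat w (fun j s => [/\ consts (env s) /\ env s vm = m,
    env s vt = t.+1 /\ env s vs = lo + j, ticks s <= T1 + 1 + j * K.+1,
    env s vfr <= 2 * n + (lo + j) * K /\ inv (env s vfr) (ram s) &
    ids_ready (ram s) t /\ forall s', lo < s' <= lo + j -> row (ram s) s'])).
  + by ev.
  + by lia.
  + rewrite /upd /= !addn0 ?mul0n ?addn0; split=> //.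
    * by split=> //; repeat apply: consts_upd => //.
    * by rewrite addn1.
    * by rewrite addn1.
    * split=> //; apply: leq_trans frt _; rewrite leq_add2l leq_mul2r; lia.
    * by split=> // s'; lia.
  + move=> j E2 M2 T2 jl [/= [c2 Em2] [Et2 Es2] ET2 [fr2 [d2 low2 rk2]] [ids2 rw2]].
    have jK : (lo + j.+1) * K <= n * K by rewrite leq_mul2r; lia.
    have jKS : (lo + j.+1) * K = (lo + j) * K + K by rewrite addnS mulSn addnC.
    asg; apply: wp_frame.
    have sn : 1 <= lo + j + 1 <= n by lia.
    eapply wp_name_row; [by apply: consts_upd|lk|exact: sn|exact: d2|rewrite /upd /=; lia|exact: rk2|].
    move=> E3 M3 d3 fr3 gr3 rf3 rw3 /= frm; rewrite {1}/upd /= in fr3.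
    have hz := nadr_lt (proj2 (andP sn)) (leqnn n); rewrite /nadr in hz.
    have pres s' : s' <= n -> row M2 s' -> row M3 s'.
      move=> s'n; have [->//|ne] := eqVneq s' (lo + j + 1).
      by apply: row_preserved ne s'n _ gr3 rf3; lia.
    split=> /=.
    * split; last by rewrite frm.
      by apply: (consts_frame (c := name_row) _ frm) => //; apply: consts_upd.
    * by rewrite !frm //= /upd /= Et2 addn1 addnS.
    * have : minn n.+1 (lo + j + 1 + K) - (lo + j + 1) <= K by lia.
      by rewrite mulSn; lia.
    * split; first by lia.
      split=> // [a ha|i ii]; first by rewrite rf3 ?low2 //; lia.
      by apply: ranked_grows gr3 _ (rk2 i ii); apply: rf3; lia.
    * split=> [s' i it hs|s' hs].
        by apply: pres (ids2 _ _ it hs); have := g_le (ltnW (leq_ltn_trans it tm)); lia.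
      have [hs'|->] : s' <= lo + j \/ s' = lo + j + 1 by lia.
        by apply: pres; [|apply: rw2]; lia.
      exact: rw3.
  + move=> [E2 M2 T2] [/= [c2 Em2] [Et2 Es2] ET2 [fr2 iv2] [ids2 rw2]].
    rewrite subnKC in fr2 rw2; last by lia.
    split=> //=.
    * have mg : mgap t = g' - lo by rewrite /mgap pE gE /lo; lia.
      by rewrite big_ord_recr /= mg; lia.
    * by rewrite (gE : nth 0 (rcons gs n.+1) t = g').
    * move=> s' i; rewrite ltnS leq_eqVlt => /orP[/eqP->|it]; last exact: ids2.
      by rewrite pE gE => hs; apply: rw2.
- move=> [E1 M1 T1] [/= [c1 Em1] Et ET [frt [d1 low1 rk1]] ids1].
  apply: (HQ _ _ _ (E1 vfr)) => //.
  have : g m * K <= n * K by rewrite leq_mul2r g_le ?orbT.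
  by lia.
Qed.

Lemma path_le_last a l : path ltn a l -> a <= last a l /\ all (leq^~ (last a l)) l.
Proof.
elim: l a => //= x l IH a /andP[ax /IH[h1 h2]]; rewrite h1 h2.
by split=> //; apply: leq_trans h1; exact: ltnW.
Qed.

Lemma g_nth t : t <= m -> g t = nth 0 (0 :: gs) t.
Proof. by case: t => // t tm /=; rewrite nth_rcons tm. Qed.

Lemma path_gs : path ltn 0 gs.
Proof. by move: gs_path; rewrite rcons_path => /andP[]. Qed.

Lemma gs_range : {in gs, forall y, 1 <= y <= n}.
Proof.
move=> y /(nthP 0)[i im <-]; have := g_le im; have := g_lt (ltnW im).
rewrite (g_nth im) => h1 h2; apply/andP; split; last exact: h2.
exact: leq_trans _ h1.
Qed.

Lemma take_gsS t : t < m -> take t.+1 gs = rcons (take t gs) (g t.+1).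
Proof. by move=> tm; rewrite (take_nth 0) // (g_nth tm). Qed.

Lemma drop_gs t : t < m -> drop t gs = g t.+1 :: drop t.+1 gs.
Proof. by move=> tm; rewrite (drop_nth 0) // (g_nth tm). Qed.

Lemma last_take_gs t : t <= m -> last 0 (take t gs) = g t.
Proof.
move=> tm; rewrite (last_nth 0) size_takel // (g_nth tm).
by case: t tm => //= t tm; rewrite nth_take.
Qed.

Lemma rest_ge t : t < m -> all (leq (g t.+2)) (drop t.+1 gs) /\
  g t.+2 \in rcons (drop t.+1 gs) n.+1.
Proof.
move=> tm.
have E : rcons (drop t.+1 gs) n.+1 = g t.+2 :: drop t.+2 (rcons gs n.+1).
  by rewrite -drop_rcons // (drop_nth 0) // size_rcons ltnS.
have : all (leq (g t.+2)) (rcons (drop t.+1 gs) n.+1).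
  rewrite E /= leqnn /=.
  have := drop_sorted t.+1 (path_sorted gs_path : sorted ltn (rcons gs n.+1)).
  rewrite (drop_nth 0) ?size_rcons ?ltnS // => /= /(order_path_min ltn_trans).
  by apply: sub_all => y /ltnW.
by rewrite all_rcons => /andP[_ ->]; split=> //; rewrite E mem_head.
Qed.

(** * Counting and thinning *)

Section Main.
Variables (M3 : nat -> nat) (fr : nat).
Hypotheses (dM : dict M3 fr) (frZ : fr < Z) (lst : listing M3).
Hypothesis rk : forall i, 1 <= i <= n -> ranked M3 i.
Hypothesis ids : ids_ready M3 m.

Definition name (q : nat * nat) := M3 (nadr q.1 q.2).

(** If [g i.+1] is the first candidate not before s, then [g i < s] and [g i.+1 <= e < s + K], so s
    is one of the starts whose row was named. *)
Lemma hit_row q : occ S K q -> hit gs q ->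
  row M3 q.1 /\ q.1 <= q.2 < minn n.+1 (q.1 + K).
Proof.
case: q => s e /and4P[/= s1 se en eK] /hasP[y /(nthP 0)[i0 i0m Ey] /= yq].
split; last by lia.
have ex : exists i, (i < m) && (s <= g i.+1 <= e).
  by exists i0; rewrite i0m (g_nth i0m) /= Ey.
case: (ex_minnP ex) => i /andP[im gi] min.
apply: (ids im); have := g_lt (ltnW im).
suff: g i < s by lia.
case: i im gi min => [|i] im gi min; first by [].
rewrite ltnNge; apply/negP => le.
have lt1 := g_lt (ltnW im); case/andP: gi => _ gi.
suff : i < i by rewrite ltnn.
by apply: min; rewrite (ltnW im) le /= (leq_trans (ltnW lt1) gi).
Qed.

Lemma name_lt q : occ S K q -> hit gs q -> name q < Z.
Proof.
move=> oq /(hit_row oq)[rw /rw[_ h]]; rewrite /name h.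
by apply: leq_ltn_trans frZ; apply: (proj1 dM); lia.
Qed.

Lemma nameP q q' : occ S K q -> occ S K q' -> hit gs q -> hit gs q' ->
  name q = name q' <-> sub S q = sub S q'.
Proof.
move=> oq oq' hq hq'; have [rw rq] := hit_row oq hq; have [rw' rq'] := hit_row oq' hq'.
case/and4P: oq => q1 q2 q3 q4; case/and4P: oq' => q1' q2' q3' q4'.
have h1 := name_eq dM frZ rk q1 q1' rw rw' rq rq'.
have h2 := eq_substring q1 q2 q3 q1' q2' q3'.
by split=> [/h1/h2|/h2/h1].
Qed.

Notation cntn := (cnt S K name).

Lemma size_occs_le : size (occs S K) <= n * n.
Proof.
by rewrite size_filter; apply: leq_trans (count_size _ _) _; rewrite size_allpairs !size_iota.
Qed.

Lemma size_rect_le p y x : p < y -> x <= n.+1 -> size (rect K p y x) <= n * n.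
Proof.
move=> py xn; apply: leq_trans size_occs_le; apply: uniq_leq_size (uniq_rect _ _ _ _) _.
by move=> q /(rect_occ py xn); rewrite mem_occs.
Qed.

Lemma cntn_le G c : cntn G c <= n * n.
Proof. exact: leq_trans (count_size _ _) size_occs_le. Qed.

Lemma nn_lt : n * n + n * n < 2 ^ w.
Proof.
have := Z_split; have : n * n <= n * z by rewrite leq_mul2l zE; lia.
by lia.
Qed.

Lemma rect_names out rest p y x M :
  all (leq^~ p) out -> p \in 0 :: out -> all (leq x) rest -> x \in rcons rest n.+1 ->
  p < y -> y < x -> x <= n.+1 -> {subset out ++ y :: rest <= gs} ->
  (forall a, 4 * Z <= a < 5 * Z -> M a = M3 a) ->
  forall q, q \in rect K p y x -> M (nadr q.1 q.2) = name q /\ name q < Z.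
Proof.
move=> h1 h2 h3 h4 h5 h6 h7 sb fM q qr.
have oq := rect_occ h5 h7 qr.
have hq : hit gs q.
  by apply: (hit_sub0 sb); move: qr; rewrite (rect_hit h1 h2 h3 h4 h5 h6 h7) // => /andP[].
split; last exact: name_lt.
rewrite fM //; case/and4P: oq => q1 q2 q3 q4; apply/andP; split.
  exact: leq_trans (leq_addr _ _) (leq_addr _ _).
exact: nadr_lt (leq_trans q2 q3) q3.
Qed.

(** Each hit occurrence is counted once, at the first candidate it contains: the rectangle from the
    previous candidate up to n + 1 is what the next candidate newly hits, by [cnt_removal] with an
    empty rest. *)
Lemma wp_count_hits E M T (Q : state -> Prop) :
  consts E -> E vm = m -> (forall a, M a = M3 a) ->
  (forall c, c < Z -> M3 (3 * Z + c) = 0) ->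
  (forall E' M' T', (forall c, c < Z -> M' (3 * Z + c) = cntn gs c) ->
     (forall a, ~~ (3 * Z <= a < 4 * Z) -> M' a = M3 a) ->
     T' <= T + \sum_(i < m) (1 + mgap i * K.+1) -> Q (State E' M' T')) ->
  wp w count_hits Q (State E M T).
Proof.
move=> cE Em EM c0 HQ; have zZ := z_le_Z; have Zs := Z_split.
rewrite /count_hits; asg.
have mn := size_gs_le.
eapply (@wp_repeat w (fun t s => [/\ consts (env s), env s vt = t,
  ticks s <= T + \sum_(i < t) (1 + mgap i * K.+1),
  forall c, c < Z -> ram s (3 * Z + c) = cntn (take t gs) c &
  forall a, ~~ (3 * Z <= a < 4 * Z) -> ram s a = M3 a])).
- by ev.
- by lia.
- rewrite /upd /= big_ord0 addn0; split=> //; first by apply: consts_upd.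
  move=> c cZ; rewrite EM c0 // take0 /cnt.
  by rewrite (eq_count (a2 := pred0)) ?count_pred0.
- move=> t E1 M1 T1 tm [/= c1 Et ET cM fM].
  have Mp : M1 (Z + t) = g t by rewrite fM ?lst //; lia.
  have Mg : M1 (Z + (t + 1)) = g t.+1 by rewrite addn1 fM ?lst //; lia.
  have gt1 := g_lt (ltnW tm); have gn := g_le tm.
  have pt : path ltn 0 (take t gs) by apply: take_path path_gs.
  have [_ al] := path_le_last pt; have ml := mem_last 0 (take t gs).
  rewrite last_take_gs ?(ltnW tm) // in al ml.
  have sb : {subset take t gs ++ g t.+1 :: [::] <= gs}.
    by move=> y; rewrite cats1 -take_gsS //; exact: mem_take.
  have rn := rect_names al ml (isT : all (leq n.+1) [::]) (mem_head _ _) gt1 gn (leqnn _) sb.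
  have rm := cnt_removal K name al ml (isT : all (leq n.+1) [::]) (mem_head _ _) gt1 gn (leqnn _).
  have mE : mgap t = minn K (g t.+1 - g t) by [].
  have szr := size_rect_le gt1 (leqnn n.+1).
  have tS := take_gsS tm.
  have [p' pE] : {p' | g t = p'} by exists (g t).
  have [g' gE] : {g' | g t.+1 = g'} by exists (g t.+1).
  rewrite !(pE, gE) in Mp Mg gt1 gn al ml sb rn rm mE szr tS.
  asg; asg; asg; asg; asg; apply: wp_frame.
  eapply (@wp_sweep name _ _ _ _ p' g' n.+1 1 (cntn (take t gs)) (E1 vfl != 0)).
  + by repeat apply: consts_upd => //.
  + by lk.
  + by lk.
  + by rewrite /upd /= addn1.
  + by lk.
  + by lia.
  + by lia.
  + by apply: rn => a ha; apply: fM; lia.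
  + exact: cM.
  + by [].
  move=> E2 M2 T2 /= _ cM2 fM2 ET2 frm; split=> /=.
  + by apply: (consts_frame (c := sweep) _ frm) => //; repeat apply: consts_upd => //.
  + by rewrite frm //= /upd /= addn1.
  + rewrite big_ord_recr /= mE; apply: leq_trans ET2 _.
    have : minn K (n.+1 - g') <= K by exact: geq_minl.
    by nia.
  + move=> c cZ; rewrite cM2 // foldl_bump_incr.
      by rewrite tS -cats1 rm cats0.
    by move=> c'; have := cntn_le (take t gs) c'; have := nn_lt; lia.
  + by move=> a ha; rewrite fM2 ?fM.
- move=> [E1 M1 T1] [/= c1 Et ET cM fM]; apply: HQ => //.
  by rewrite take_size in cM.
Qed.

Lemma attractor_irredundant (G G' : seq nat) y : {subset G' <= G} ->
  {in G, forall j, 1 <= j <= n} ->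
  ~ attractor K S [predD1 mem G & y] -> ~ attractor K S [predD1 mem G' & y].
Proof.
move=> sb rng nA A; apply: nA; apply: attractor_mono A.
  by move=> j; rewrite !inE => /andP[-> /sb].
by move=> j; rewrite !inE => /andP[_ /rng].
Qed.

Lemma wp_greedy E M T (Q : state -> Prop) :
  consts E -> E vm = m -> attractor K S (mem gs) ->
  (forall c, c < Z -> M (3 * Z + c) = cntn gs c) ->
  (forall a, ~~ (3 * Z <= a < 4 * Z) -> M a = M3 a) ->
  (forall E' M' T' out, uniq out -> minimal_attractor K S (mem out) ->
     M' 0 = size out -> (forall i, i < size out -> M' i.+1 = nth 0 out i) ->
     T' <= T + \sum_(i < m) (1 + 2 * (K * (mgap i.+1).+1)) -> Q (State E' M' T')) ->
  wp w greedy Q (State E M T).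
Proof.
move=> cE Em attr cM0 fM0 HQ; have zZ := z_le_Z; have Zs := Z_split.
rewrite /greedy; asg; asg; asg; sq.
have mn := size_gs_le.
(* The current set is the kept points followed by the undecided ones; indispensability is claimed
   for the kept ones only. *)
pose abs t out := [/\ path ltn 0 out, last 0 out <= g t,
  {subset out ++ drop t gs <= gs}, attractor K S (mem (out ++ drop t gs)) &
  {in out, forall y, ~ attractor K S [predD1 mem (out ++ drop t gs) & y]}].
pose conc t out E1 M1 := [/\ consts E1, E1 vt = t /\ E1 vp = last 0 out,
  E1 voc = size out /\ size out <= t,
  forall i, i < size out -> M1 i.+1 = nth 0 out i &
  (forall c, c < Z -> M1 (3 * Z + c) = cntn (out ++ drop t gs) c) /\
  (forall a, Z <= a -> ~~ (3 * Z <= a < 4 * Z) -> M1 a = M3 a)].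
eapply (@wp_repeat w (fun t s => exists out, [/\ abs t out,
  conc t out (env s) (ram s) &
  ticks s <= T + \sum_(i < t) (1 + 2 * (K * (mgap i.+1).+1))])).
- by ev.
- by lia.
- exists [::]; rewrite /abs /conc drop0 /= big_ord0 addn0; split; [by split| |by []].
  split=> //; first by repeat apply: consts_upd => //.
  by split=> // a _ ha; apply: fM0.
- move=> t E1 M1 T1 tm [out [/= [po lo sb at1 irr] [c1 [Et Ep] [Eo so] Mo [cM fM]] ET]].
  have Mg : M1 (Z + (t + 1)) = g t.+1 by rewrite addn1 fM ?lst //; lia.
  have Mx : M1 (Z + (t + 1 + 1)) = g t.+2 by rewrite !addn1 fM ?lst //; lia.
  have gt1 := g_lt (ltnW tm); have gn := g_le tm; have gx := g_lt tm.
  have pg : last 0 out < g t.+1 by apply: leq_ltn_trans gt1.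
  have xn : g t.+2 <= n.+1.
    have [tm'|tm'] := ltnP t.+1 m; first exact: leqW (g_le tm').
    have -> : t.+1 = m by lia.
    by rewrite /= nth_rcons ltnn eqxx.
  have [_ al] := path_le_last po; have ml := mem_last 0 out.
  have [rge xin] := rest_ge tm.
  rewrite (drop_gs tm) in sb at1 irr cM.
  set rest := drop t.+1 gs in sb at1 irr cM rge xin *.
  have rn := rect_names al ml rge xin pg gx xn sb.
  have rm := cnt_removal K name al ml rge xin pg gx xn.
  have ar := attractor_removal nameP gs_range al ml rge xin pg gx xn sb at1.
  have szr := size_rect_le pg xn.
  have mE : mgap t.+1 = minn K (g t.+2 - g t.+1) by [].
  have [p' pE] : {p' | last 0 out = p'} by exists (last 0 out).
  have absS out' : {subset out' ++ rest <= out ++ g t.+1 :: rest} ->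
      path ltn 0 out' -> last 0 out' <= g t.+1 ->
      attractor K S (mem (out' ++ rest)) ->
      {in out', forall y, y \in out \/ ~ attractor K S [predD1 mem (out' ++ rest) & y]} ->
      abs t.+1 out'.
    move=> sb' po' lo' at' irr'; split=> //; first by move=> y /sb'/sb.
    move=> y /irr'[yo|//].
    apply: (@attractor_irredundant (out ++ g t.+1 :: rest)) (irr y yo) => //.
    by move=> j /sb/gs_range.
  have [g' gE] : {g' | g t.+1 = g'} by exists (g t.+1).
  have [x' xE] : {x' | g t.+2 = x'} by exists (g t.+2).
  rewrite !(pE, gE, xE) in Mg Mx Ep gt1 gn gx xn al ml sb at1 irr cM rge xin rn rm ar szr mE pg absS.
  asg; asg; asg; asg; sq; eapply wp_asgn; first by apply: eval_max_word; lia.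
  sq; apply: wp_frame.
  have nn := nn_lt.
  eapply (@wp_sweep name _ _ _ _ p' g' x' (2 ^ w - 1) (cntn (out ++ g' :: rest)) true).
  + by repeat apply: consts_upd => //.
  + by lk.
  + by lk.
  + by lk.
  + by lk.
  + by lia.
  + by lia.
  + by apply: rn => a ha; apply: fM; lia.
  + exact: cM.
  + by [].
  move=> E2 M2 T2 /=.
  have [|D1 D2] := @foldl_bump_decr name (cntn (out ++ g' :: rest)) true (rect K p' g' x').
    move=> c; have := cntn_le (out ++ g' :: rest) c; rewrite rm; lia.
  rewrite D2 => fl2 cM2 fM2 ET2 frm.
  have {D1}cM2 c : c < Z -> M2 (3 * Z + c) = cntn (out ++ rest) c.
    by move=> cZ; rewrite cM2 // D1 rm addnK.
  (* The old counter is the new one plus the number of decrements, so the flag says that all new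
     counters in the rectangle are positive. *)
  have {D2}fl2 : (E2 vfl != 0) = all (fun q => 0 < cntn (out ++ rest) (name q)) (rect K p' g' x').
    rewrite fl2 /=; apply: eq_all => q; rewrite rm.
    by rewrite -{1}[count _ _]add0n ltn_add2r.
  have c2 : consts E2.
    by apply: (consts_frame (c := sweep) _ frm) => //; repeat apply: consts_upd => //.
  have Ep2 : E2 vp = p' by rewrite frm //= /upd /= Ep.
  have Eg2 : E2 vg = g' by rewrite frm.
  have Ex2 : E2 vx = x' by rewrite frm.
  have Eo2 : E2 voc = size out by rewrite frm //= /upd /= Eo.
  have Et2 : E2 vt = t.+1 by rewrite frm //= /upd /= addn1.
  have tb : minn K (g' - p') * (minn K (x' - g')).+1 <= K * (mgap t.+1).+1.
    by rewrite mE leq_mul2r geq_minl orbT.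
  eapply wp_if; [by ev| |] => fl.
    exists out; split=> /=; last by rewrite big_ord_recr /=; lia.
      apply: absS => //.
      * by move=> y; rewrite !mem_cat inE => /orP[->|->]; rewrite ?orbT.
      * by rewrite pE ltnW.
      * by apply/ar; rewrite -fl2.
      * by move=> y; left.
    split=> //.
    * by rewrite pE.
    * by split=> //; apply: leqW.
    * by move=> i io; rewrite fM2 ?Mo //; lia.
    * by split=> // a Za ha; rewrite fM2 ?fM.
  asg; sq; apply: wp_frame.
  eapply (@wp_sweep name _ _ _ _ p' g' x' 1 (cntn (out ++ rest)) false).
  + by repeat apply: consts_upd => //.
  + by lk.
  + by lk.
  + by lk.
  + by lk.
  + by lia.
  + by lia.
  + by apply: rn => a ha; rewrite fM2 ?fM //; lia.
  + exact: cM2.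
  + by rewrite /upd /= fl.
  move=> E3 M4 T3 /= _ cM3 fM3 ET3 frm3.
  have {}cM3 c : c < Z -> M4 (3 * Z + c) = cntn (out ++ g' :: rest) c.
    move=> cZ; rewrite cM3 // foldl_bump_incr ?rm // => c'.
    by have := cntn_le (out ++ rest) c'; lia.
  have c3 : consts E3.
    by apply: (consts_frame (c := sweep) _ frm3) => //; repeat apply: consts_upd => //.
  have Eg3 : E3 vg = g' by rewrite frm3 //= /upd /= Eg2.
  have Eo3 : E3 voc = size out by rewrite frm3 //= /upd /= Eo2.
  have Et3 : E3 vt = t.+1 by rewrite frm3 //= /upd /= Et2.
  asg; sto; asg.
  exists (rcons out g'); split=> /=; last by rewrite big_ord_recr /=; lia.
    apply: absS.
    * by move=> y; rewrite cat_rcons.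
    * by rewrite rcons_path po pE.
    * by rewrite last_rcons.
    * by rewrite cat_rcons.
    * move=> y; rewrite mem_rcons inE => /orP[/eqP->|]; last by left.
      (* Without g' the current set is [out ++ rest], which failed the test; by the strict order g'
         occurs in neither part. *)
      right=> A; have : ~ attractor K S (mem (out ++ rest)).
        by move/ar; rewrite -fl2 fl.
      apply; apply: eq_attractor A => j; rewrite !inE !mem_cat mem_rcons inE.
      have [->|ne] //= := eqVneq j g'; apply/esym/negbTE; rewrite negb_or.
      apply/andP; split; apply/negP => jin.
        by have := allP al _ jin; rewrite /=; lia.
      by have := allP rge _ jin; rewrite /=; lia.
  split=> //=.
  + by repeat apply: consts_upd => //.
  + by rewrite /upd /= last_rcons.
  + by rewrite /upd /= size_rcons addn1.
  + move=> i; rewrite size_rcons ltnS nth_rcons => io.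
    have [->|ne] := eqVneq i (size out); first by rewrite ltnn addn1 upd_same.
    have io' : i < size out by lia.
    by rewrite io' upd_other ?fM3 ?fM2 ?Mo //; lia.
  + rewrite cat_rcons; split=> [c cZ|a Za ha]; first by rewrite upd_other ?cM3 //; lia.
    by rewrite upd_other ?fM3 ?fM2 ?fM //; lia.
- move=> [E1 M1 T1] [out [/= [po lo sb at1 irr] [c1 [Et Ep] [Eo so] Mo [cM fM]] ET]].
  rewrite drop_size cats0 in at1 irr.
  sto; apply: (HQ _ _ _ out) => //.
  by move: (path_sorted po); apply: sorted_uniq; [exact: ltn_trans|exact: ltnn].
Qed.

End Main.
End Candidates.

Lemma wp_init M T (Q : state -> Prop) sigma k :
  M 0 = n -> M 1 = sigma -> M 2 = k ->
  sg = minn sigma n.+1 -> K = minn k n ->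
  (forall E', consts E' -> Q (State E' M T)) ->
  wp w init Q (State (fun=> 0) M T).
Proof.
move=> M0 M1 M2 sgE KE HQ; have zZ := z_le_Z; rewrite /init.
asg; asg; sq.
eapply (@wp_cond_asgn w _ _ _ _ _ _ _ (n < sigma)); [by ev|by move=> _; ev|].
asg; sq.
eapply (@wp_cond_asgn w _ _ _ _ _ _ _ (n < k)); [by ev|by move=> _; ev|].
asg; asg.
sq; eapply wp_asgn.
  eapply eval_add; [eapply eval_div; [apply: eval_max_word; lia|by ev]|by ev|lia].
rewrite -!zE -!ZE.
asg; asg; asg; asg; asg; apply: HQ; split; rewrite /upd //= ?ZE //.
- by rewrite sgE; case: ifP; lia.
- by rewrite KE; case: ifP; lia.
- by lia.
Qed.

(** Once P exceeds n it is frozen, while [sg ^ j] never decreases; so n < P still reports on the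
    true power. *)
Lemma iter_capped_power j : 0 < sg <= n.+1 -> 0 < n ->
  let P := iter j (fun P => if n < P then P else P * sg) 1 in
  [/\ 0 < P, P <= n * n.+1, P <= n -> P = sg ^ j & n < P -> n < sg ^ j].
Proof.
move=> sgb n0; elim: j => [|j /=]; first by split=> //; rewrite ?muln_gt0; lia.
set P := iter _ _ _ => -[P0 Pb Pe Pl]; case: (ltnP n P) => Pn; split=> //.
- by rewrite leqNgt Pn.
- by move=> _; apply: leq_trans (Pl Pn) _; rewrite expnS leq_pmull; lia.
- by rewrite muln_gt0 P0; lia.
- by apply: leq_mul; lia.
- by move=> _; rewrite Pe // expnSr.
- by rewrite Pe // expnSr.
Qed.

(** * The candidate set and the total cost *)

Section Final.
Variables sigma k : nat.
Hypotheses (sgE : sg = minn sigma n.+1) (KE : K = minn k n).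
Hypothesis letters : forall i, 1 <= i <= n -> 1 <= letter S i <= sigma.

Definition power := iter K (fun P => if n < P then P else P * sg) 1.

Lemma sg_range : 0 < sg <= n.+1.
Proof. by rewrite sgE; have := letters (i := 1); lia. Qed.

Lemma power_range : 0 < power <= n * n.+1.
Proof. by have [|h1 h2 _ _] := @iter_capped_power K sg_range; [lia|apply/andP]. Qed.

(** As K >= 1, [sg <= sg ^ K <= n], so cutting the alphabet at n + 1 changed nothing. *)
Lemma power_small : power <= n -> power = sigma ^ K /\ sg = sigma.
Proof.
have [|h1 h2 h3 h4] := @iter_capped_power K sg_range; first lia.
move=> Pn; have E := h3 Pn; have sgn : sg <= n.
  apply: leq_trans Pn; rewrite /power E -{1}(expn1 sg) leq_pexp2l //.
  by case/andP: sg_range.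
have sgs : sg = sigma by rewrite sgE; rewrite sgE in sgn; lia.
by rewrite /power E sgs.
Qed.

Lemma power_large : n < power -> n < sigma ^ K.
Proof.
have [|h1 h2 h3 h4] := @iter_capped_power K sg_range; first lia.
move=> /h4 lt; apply: leq_trans lt _; rewrite leq_exp2r // sgE; exact: geq_minl.
Qed.

Lemma selection_attractor gs : selection power n gs -> attractor K S (mem gs).
Proof.
move=> sl; have [ps al cv un] := sl.
apply: windows_attractor => [g gin|i iN].
  rewrite (allP al _ gin) andbT lt0n; apply: contraTneq gin => ->.
  exact: selection_lt0 sl.
have [iin|[Pn Ki [j [jin Kj Ej]]]] := cv i iN; [by left|right].
exists j; split=> //; have [PE sgs] := power_small Pn.
have jn := allP al _ jin; have P0 := power_range.
have sn : sigma <= n.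
  by apply: leq_trans Pn; rewrite PE -{1}(expn1 sigma) leq_pexp2l //; have := sg_range; lia.
have nz : power * sigma + sigma < 2 ^ w.
  have : power * sigma <= n * z by apply: leq_mul => //; lia.
  by have := Z_split; have := z_le_Z; lia.
rewrite sgs in Ej.
apply: (code_inj letters (proj1 (andP P0)) nz) => //; first by rewrite -PE.
- by rewrite Ki; case/andP: iN.
- by rewrite Kj.
- by rewrite Ej.
Qed.

Lemma sum_affine m (f : nat -> nat) a b :
  \sum_(i < m) (a + f i * b) = a * m + b * \sum_(i < m) f i.
Proof.
rewrite big_split /= sum_nat_const card_ord mulnC; congr (_ + _).
by rewrite big_distrr /=; apply: eq_bigr => i _; rewrite mulnC.
Qed.

Section Cost.
Variable gs : seq nat.
Hypothesis sl : selection power n gs.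
Notation D := (capped_gaps K 0 (rcons gs n.+1)).

Lemma selection_path : path ltn 0 (rcons gs n.+1).
Proof.
have [ps al _ _] := sl; rewrite rcons_path ps /=.
by have := mem_last 0 gs; rewrite inE => /orP[/eqP->//|/(allP al)]; rewrite ltnS.
Qed.

Lemma gaps_le : D <= n.+1.
Proof. by have := capped_gaps_last K selection_path; rewrite last_rcons addn0. Qed.

(** The candidates below K cost at most K in all, the others have distinct codes below [power], and
    one more term accounts for the sentinel n + 1. *)
Lemma gaps_le_power : power <= n -> D <= K + K * power.+1.
Proof.
move=> Pn; apply: leq_trans (capped_gaps_count K selection_path) _.
rewrite subn0 leq_add2l leq_mul2l -cats1 count_cat /= addn0 -(addn1 power).
apply/orP; right; apply: leq_add; last exact: leq_b1.
rewrite -size_filter -(size_map (code S w sg power)) -{2}(size_iota 0 power).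
have [_ _ _ un] := sl; apply: uniq_leq_size (un Pn) _ => c /mapP[j _ ->].
by rewrite mem_iota /=; apply: code_lt; case/andP: power_range.
Qed.

Lemma gapsE : D = \sum_(i < (size gs).+1) mgap gs i.
Proof. by rewrite capped_gapsE size_rcons. Qed.

(** Naming and counting cost at most 3 K D each and the greedy pass 5 K D. The number of candidates
    is absorbed because every gap adds at least 1 to D. *)
Lemma total_cost :
  \sum_(i < size gs) (1 + mgap gs i * K.+1) +
  \sum_(i < size gs) (1 + mgap gs i * K.+1) +
  \sum_(i < size gs) (1 + 2 * (K * (mgap gs i.+1).+1)) <= 11 * (K * D).
Proof.
have mD : (size gs).+1 <= D.
  by rewrite -(size_rcons gs n.+1); apply: size_le_capped_gaps selection_path.
rewrite !sum_affine.
have -> : \sum_(i < size gs) (1 + 2 * (K * (mgap gs i.+1).+1)) =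
          size gs + 2 * K * (size gs + \sum_(i < size gs) mgap gs i.+1).
  have <- : \sum_(i < size gs) (mgap gs i.+1).+1 =
            size gs + \sum_(i < size gs) mgap gs i.+1.
    have := sum_affine (size gs) (fun i => mgap gs i.+1) 1 1.
    by rewrite !mul1n => <-; apply: eq_bigr => i _; rewrite muln1.
  have := sum_affine (size gs) (fun i => (mgap gs i.+1).+1) 1 (2 * K).
  rewrite mul1n => <-; apply: eq_bigr => i _; congr (_ + _).
  by rewrite mulnA mulnC.
have E1 : \sum_(i < size gs) mgap gs i <= D by rewrite gapsE big_ord_recr /= leq_addr.
have E2 : \sum_(i < size gs) mgap gs i.+1 <= D by rewrite gapsE big_ord_recl /= leq_addl.
set s1 := \sum_(i < size gs) mgap gs i in E1 *.
set s2 := \sum_(i < size gs) mgap gs i.+1 in E2 *.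
move: D mD E1 E2 => d mD E1 E2.
have h1 : K.+1 * s1 <= 2 * (K * d).
  by rewrite mulnA; apply: leq_mul => //; lia.
have h2 : 2 * K * (size gs + s2) <= 4 * (K * d).
  have -> : 4 * (K * d) = 2 * K * (2 * d) by lia.
  by rewrite leq_mul2l; lia.
have h3 : d <= K * d by rewrite leq_pmull.
by lia.
Qed.

End Cost.

Lemma wp_find_attractor M : M 0 = n -> M 1 = sigma -> M 2 = k ->
  input_ram M -> (forall a, n + 2 < a -> M a = 0) ->
  wp w find_attractor (fun s => exists out, [/\ uniq out,
    minimal_attractor K S (mem out), ram s 0 = size out,
    forall i, i < size out -> ram s i.+1 = nth 0 out i & ticks s <=
    36 * minn (n ^ 2) (minn (n * k ^ 2) (n + sigma ^ (2 * k - 1) * k ^ 2))])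
  (State (fun=> 0) M 0).
Proof.
move=> M0 M1 M2 inp Mz; have zZ := z_le_Z; have Zs := Z_split.
have sgn := sg_range; have Pb := power_range.
rewrite /find_attractor; sq; apply: (wp_init M0 M1 M2 sgE KE) => E1 c1.
sq; apply: wp_rank_letters => // E2 R2 c2 low2 fr2 d2 rk2.
sq; apply: wp_capped_power => //; first by lia.
rewrite -/power; have c3 : consts (upd E2 vP power) by apply: consts_upd.
have inp2 : input_ram R2 by move=> i iN; rewrite low2 ?inp //; lia.
sq; apply: wp_frame; apply: (wp_select (P := power)) => //; [lia|lia| |].
  by move=> a ha; rewrite low2 ?Mz //; lia.
move=> E4 R4 gs c4 Em4 sl4 fR4 lst4 /= frm4.
have gp := selection_path sl4; have attr := selection_attractor sl4.
have fr4 : E4 vfr = E2 vfr by rewrite frm4.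
have low4 a : 3 * Z <= a -> R4 a = R2 a by move=> ha; apply: fR4; lia.
have gr24 : grows R2 R4 by move=> a ha _; apply: low4; lia.
sq; apply: (wp_name_occurrences gp) => //.
- by rewrite fr4.
- by rewrite fr4; apply: dict_low d2 => a ha; apply: low4; lia.
- by move=> i iN; apply: ranked_grows gr24 _ (rk2 i iN); apply: low4; lia.
move=> E5 R5 T5 fr5 c5 Em5 d5 fr5Z low5 rk5 ids5 ET5.
have lst5 : listing gs R5.
  by move=> t tm; rewrite low5 ?lst4 //; have := selection_size sl4; lia.
sq; apply: wp_frame; apply: (wp_count_hits gp d5 fr5Z lst5) => //.
  by move=> c cZ; rewrite low5 ?low4 ?low2 ?Mz //; lia.
move=> E6 R6 T6 cM6 fM6 ET6 /= frm6.
apply: (wp_greedy gp d5 fr5Z lst5) => //.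
- exact: (consts_frame (c := count_hits) _ frm6).
- by rewrite frm6.
move=> E7 R7 T7 out uo mo h0 hi ET7; exists out; split=> //=.
have tot := total_cost sl4.
set D := capped_gaps _ _ _ in tot.
(* The term 3 n covers n iterations for the ranks, n for the selection and K <= n for the power. *)
apply: (@leq_trans (3 * n + 11 * (K * D))); first by lia.
apply: (cost_bound_arith (P := power)).
- by lia.
- by rewrite K_gt0.
- by rewrite KE geq_minl.
- by have := sg_range; lia.
- by case/andP: Pb.
- exact: gaps_le.
- by move=> Pn; split; [case: (power_small Pn)|exact: gaps_le_power].
- exact: power_large.
Qed.

End Final.

End Verification.

(** * Word length and constants *)

Lemma nth_input S sigma k i :
  1 <= i <= size S -> nth 0 [:: size S, sigma, k & S] (i + 2) = letter S i.
Proof. by case: i => // i _; rewrite addnC. Qed.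

Theorem theorem30 :
  exists (p : program) (a : nat), 0 < a /\
  forall b : nat, exists C : nat,
  forall (w n sigma k : nat) (S : seq nat),
    0 < n -> size S = n ->
    all (fun x => 1 <= x <= sigma) S ->
    1 <= k ->
    a * bit_length n <= w <= b * bit_length n ->
    sigma < 2 ^ w -> k < 2 ^ w ->
    finds_minimal_attractor w p S sigma k /\
    expected_time_le w p (input S sigma k)
      (C * minn (n ^ 2) (minn (n * k ^ 2) (n + sigma ^ (2 * k - 1) * k ^ 2))).
Proof.
(* The factor 40 is generous: the memory bound below is derived from [12 * L + 4 <= w.-1]. *)
exists (compile find_attractor 0 0), 40; split=> // b.
(* 37 is 36 + 1: the successor of the tick count in the time bound is absorbed by the minimum, which
   is positive. *)
exists (weight find_attractor * 37) => w n sigma k S n0 nE letS k0 /andP[wa _] sw _.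
rewrite -nE in n0 wa *; set L := bit_length (size S) in wa.
have w0 : 0 < w by rewrite /L /bit_length in wa; lia.
have letters i : 1 <= i <= size S -> 1 <= letter S i <= sigma.
  by case: i => // i iN; apply: (allP letS); apply: mem_nth.
pose z := size S + 4; pose Z := z * z; pose H := 2 ^ w.-1.
have HW : H + H = 2 ^ w by rewrite addnn -mul2n -expnS prednK.
have ZH : Z * Z + 8 * Z < H.
  have L1 : 1 <= L by [].
  have nL : size S < 2 ^ L by apply: trunc_log_ltn.
  have zL : z <= 2 ^ (3 * L).
    apply: (@leq_trans (2 ^ (L + 2))); first by rewrite expnD /z; lia.
    by rewrite leq_exp2l //; lia.
  have ZL : Z <= 2 ^ (6 * L).
    by have -> : 6 * L = 3 * L + 3 * L by [lia]; rewrite expnD; apply: leq_mul.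
  have ZZ : Z * Z <= 2 ^ (12 * L).
    by have -> : 12 * L = 6 * L + 6 * L by [lia]; rewrite expnD; apply: leq_mul.
  have Z1 : 1 * Z <= Z * Z by apply: leq_mul => //; rewrite /Z /z; lia.
  have : 2 ^ (12 * L) * 2 ^ 4 <= H.
    by rewrite -expnD leq_exp2l //; lia.
  have : 0 < 2 ^ (12 * L) by rewrite expn_gt0.
  by rewrite (_ : 2 ^ 4 = 16) //; lia.
have K0 : 0 < minn k (size S) by lia.
have llt i : 1 <= i <= size S -> letter S i < 2 ^ w.
  by move=> /letters; lia.
pose M := nth 0 [:: size S, sigma, k & S].
have inp : input_ram S M by move=> i; exact: nth_input.
have Mz a : size S + 2 < a -> M a = 0 by move=> ha; apply: nth_default => /=; lia.
have [halt time] := @compile_run w find_attractor M w0.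
have [out [uo mo h0 hi tk]] :=
  wp_find_attractor (erefl z) (erefl Z) HW ZH K0 (geq_minr k (size S)) llt
    (erefl (minn sigma (size S).+1)) (erefl (minn k (size S))) letters
    (erefl _ : M 0 = size S) (erefl _ : M 1 = sigma) (erefl _ : M 2 = k) inp Mz.
split=> [N r c hr|].
  have cE := halt _ hr.
  suff -> : output c = out.
    by split=> //; apply: minimal_attractor_minn.
  rewrite /output cE h0; apply: (@eq_from_nth _ 0); first by rewrite size_map size_iota.
  move=> i; rewrite size_map size_iota => io.
  by rewrite (nth_map 0) ?size_iota // nth_iota // cE add1n hi.
apply: expected_time_bound => rs; apply: leq_trans (time rs) _.
rewrite -mulnA leq_mul2l; apply/orP; right.
set B := minn (_ ^ 2) _ in tk *; have : 0 < B.
  by rewrite /B !leq_min addn_gt0 !muln_gt0 n0 k0.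
by lia.
Qed.
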